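(* Let $T$ be a complete first-order theory which is NTP$_{2}$, and let $M\models T$. Then for every Keisler measure $\mu$ over $M$ in the variable $x$, there exist an elementary extension $N\succ M$ (inside the monster model) and a Keisler measure $\mu'$ over $N$ in the variable $x$ extending $\mu$ such that $\mu'$ is NTP$_{2}$-smooth.
   Context: $\mathfrak{C}$ denotes the monster model of $T$. A Keisler measure over a set $A$ in the variable $x$ is a finitely additive probability measure on the Boolean algebra $L_{x}(A)$ of formulas (definable sets) in $x$ with parameters from $A$. A formula $\varphi(x,y)$ has TP$_{2}$ if there are an array $\langle a_{i,j} : i,j<\omega\rangle$ and $k<\omega$ such that for every $\eta:\omega\to\omega$ the set $\{\varphi(x,a_{i,\eta(i)}) : i<\omega\}$ is consistent and each row $\{\varphi(x,a_{i,j}) : j<\omega\}$ is $k$-inconsistent; $T$ is NTP$_{2}$ if no formula has TP$_{2}$. A formula $\varphi(x,b)$ divides over $A$ if there is an $A$-indiscernible sequence $\langle b_i:i<\omega\rangle$ with $b_0=b$ such that $\{\varphi(x,b_i):i<\omega\}$ is inconsistent. A Keisler measure $\mu$ over $A$ in $x$ is NTP$_{2}$-smooth if for every set $B\supseteq A$ and every Keisler measure $\mu''$ over $B$ in $x$ extending $\mu$, every formula $\varphi(x,b)\in L_x(B)$ which divides over $A$ satisfies $\mu''(\varphi(x,b))=0$. *)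

(* Defs.v *)
From mathcomp Require Import all_boot all_order all_algebra.
From mathcomp Require Import all_classical all_reals.

Set Implicit Arguments.
Unset Strict Implicit.
Unset Printing Implicit Defensive.

Local Open Scope classical_set_scope.
Local Open Scope ring_scope.

Record language := Language {
  fsym : Type;
  farity : fsym -> nat;
  rsym : Type;
  rarity : rsym -> nat }.

Inductive term (L : language) (V : Type) : Type :=
| tvar of V
| tapp (f : fsym L) of ('I_(farity f) -> term L V).

(* [formula L V]: first-order L-formulas with equality whose free variables
   are among the elements of [V]; a quantifier binds [None]. A partitioned
   formula phi(x, y) with |x| = n, |y| = m is a [formula L ('I_n + 'I_m)]. *)
Inductive formula (L : language) (V : Type) : Type :=
| fbot
| feq of term L V & term L V
| fatom (r : rsym L) of ('I_(rarity r) -> term L V)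
| fimp of formula L V & formula L V
| fall of formula L (option V).

Arguments tvar {L V}.
Arguments tapp {L V}.
Arguments fbot {L V}.
Arguments feq {L V}.
Arguments fatom {L V}.
Arguments fimp {L V}.
Arguments fall {L V}.

Definition fnot L V (phi : formula L V) : formula L V := fimp phi fbot.

Definition sentence (L : language) := formula L void.

Record structure (L : language) := Structure {
  dom :> Type;
  dom_inhabited : inhabited dom;
  fint : forall f : fsym L, ('I_(farity f) -> dom) -> dom;
  rint : forall r : rsym L, ('I_(rarity r) -> dom) -> Prop }.

Arguments fint {L} s f.
Arguments rint {L} s r.

Fixpoint eval L (C : structure L) V (v : V -> C) (t : term L V) : C :=
  match t with
  | tvar x => v x
  | tapp f ts => fint C f (fun i => eval v (ts i))
  end.

Fixpoint sat L (C : structure L) V (v : V -> C) (phi : formula L V) : Prop :=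
  match phi with
  | fbot => False
  | feq s t => eval v s = eval v t
  | fatom r ts => rint C r (fun i => eval v (ts i))
  | fimp p q => sat v p -> sat v q
  | fall p => forall c : C, sat (oapp v c) p
  end.

Definition holds L (C : structure L) (phi : sentence L) : Prop :=
  sat (of_void C) phi.

Definition theory (L : language) := set (sentence L).

Definition models L (C : structure L) (T : theory L) : Prop :=
  forall phi, T phi -> holds C phi.

Definition entails L (T : theory L) (phi : sentence L) : Prop :=
  forall C : structure L, models C T -> holds C phi.

Definition complete_theory L (T : theory L) : Prop :=
  (exists C : structure L, models C T) /\
  forall phi, entails T phi \/ entails T (fnot phi).

Section Substructures.
Variables (L : language) (C : structure L).

Definition fclosed (A : set C) : Prop :=
  forall (f : fsym L) (a : 'I_(farity f) -> C),
    (forall i, A (a i)) -> A (fint C f a).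

Lemma sub_inhabited (A : set C) : A !=set0 -> inhabited {c : C | A c}.
Proof. by case=> c Ac; exact: (inhabits (exist _ c Ac)). Qed.

Definition substructure (A : set C) (A0 : A !=set0) (Af : fclosed A) :
    structure L :=
  {| dom := {c : C | A c};
     dom_inhabited := sub_inhabited A0;
     fint := fun f a => exist A (fint C f (fun i => sval (a i)))
                          (Af f (fun i => sval (a i)) (fun i => svalP (a i)));
     rint := fun r a => rint C r (fun i => sval (a i)) |}.

Definition elementary_substructure (A : set C) : Prop :=
  exists (A0 : A !=set0) (Af : fclosed A),
    forall (m : nat) (phi : formula L 'I_m) (a : 'I_m -> substructure A0 Af),
      sat a phi <-> sat (fun i => sval (a i) : C) phi.

End Substructures.

Section Definable.
Variables (L : language) (C : structure L).

Definition valpair n m (a : 'I_n -> C) (b : 'I_m -> C) (x : 'I_n + 'I_m) : C :=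
  match x with inl i => a i | inr j => b j end.

(* The set phi(C, b) defined by phi(x, b). *)
Definition defset n m (phi : formula L ('I_n + 'I_m)) (b : 'I_m -> C) :
    set ('I_n -> C) :=
  [set a | sat (valpair a b) phi].

(* The elements of L_x(A), |x| = n: formulas over A are identified with the
   sets that they define in the monster model. *)
Definition definable n (A : set C) (D : set ('I_n -> C)) : Prop :=
  exists (m : nat) (phi : formula L ('I_n + 'I_m)) (b : 'I_m -> C),
    (forall j, A (b j)) /\ D = defset phi b.

(* Consistency with the elementary diagram of C: by compactness, this is
   finite satisfiability in C. *)
Definition consistent n (p : set (set ('I_n -> C))) : Prop :=
  forall F : set (set ('I_n -> C)), finite_set F -> F `<=` p ->
    \bigcap_(D in F) D !=set0.

Definition automorphism (s : C -> C) : Prop :=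
  [/\ bijective s,
      forall (f : fsym L) a, s (fint C f a) = fint C f (fun i => s (a i)) &
      forall (r : rsym L) a, rint C r a <-> rint C r (fun i => s (a i))].

(* [h] restricted to [A] is a partial elementary map. *)
Definition elementary_on (A : set C) (h : C -> C) : Prop :=
  forall (m : nat) (phi : formula L 'I_m) (a : 'I_m -> C),
    (forall i, A (a i)) -> sat a phi <-> sat (fun i => h (a i)) phi.

End Definable.

(* A type [K] stands for its cardinal kappa = |K|. *)
Definition card_lt T U (A : set T) (B : set U) : Prop := ~ (B #<= A)%card.

Definition small L (K : Type) (C : structure L) (A : set C) : Prop :=
  card_lt A [set: K].

Definition saturated L (K : Type) (C : structure L) : Prop :=
  forall A : set C, small K A ->
  forall (n : nat) (p : set (set ('I_n -> C))),
    p `<=` definable A -> consistent p -> \bigcap_(D in p) D !=set0.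

Definition strongly_homogeneous L (K : Type) (C : structure L) : Prop :=
  forall A : set C, small K A ->
  forall h : C -> C, elementary_on A h ->
    exists2 s : C -> C, automorphism s & {in A, s =1 h}.

(* C is a kappa-saturated, strongly kappa-homogeneous model of T, for a
   cardinal kappa > |L| + aleph_0. *)
Definition monster_model L (K : Type) (T : theory L) (C : structure L) : Prop :=
  [/\ card_lt [set: nat] [set: K],
      card_lt [set: fsym L] [set: K] /\ card_lt [set: rsym L] [set: K],
      models C T,
      saturated K C &
      strongly_homogeneous K C].

Section Dividing.
Variables (L : language) (C : structure L).

(* k-inconsistency refers to k distinct indices, not k distinct formulas. *)
Definition k_inconsistent n (k : nat) (D : nat -> set ('I_n -> C)) : Prop :=
  forall s : seq nat, uniq s -> size s = k ->
    ~ exists a, forall j, j \in s -> D j a.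

Definition TP2 n m (phi : formula L ('I_n + 'I_m)) : Prop :=
  exists (a : nat -> nat -> 'I_m -> C) (k : nat),
    (forall eta : nat -> nat,
       consistent (range (fun i => defset phi (a i (eta i))))) /\
    (forall i, k_inconsistent k (fun j => defset phi (a i j))).

Definition NTP2 : Prop :=
  forall (n m : nat) (phi : formula L ('I_n + 'I_m)), ~ TP2 phi.

Definition seqval m k p (b : nat -> 'I_m -> C) (i : 'I_k -> nat)
    (c : 'I_p -> C) (x : 'I_k * 'I_m + 'I_p) : C :=
  match x with inl (r, s) => b (i r) s | inr q => c q end.

Definition indiscernible m (A : set C) (b : nat -> 'I_m -> C) : Prop :=
  forall (k p : nat) (psi : formula L ('I_k * 'I_m + 'I_p)) (c : 'I_p -> C)
    (i j : 'I_k -> nat),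
    (forall q, A (c q)) ->
    {homo i : r s / (r < s)%N} -> {homo j : r s / (r < s)%N} ->
    sat (seqval b i c) psi <-> sat (seqval b j c) psi.

Definition divides n m (A : set C) (phi : formula L ('I_n + 'I_m))
    (b : 'I_m -> C) : Prop :=
  exists bs : nat -> 'I_m -> C,
    [/\ indiscernible A bs, bs 0%N = b &
        ~ consistent (range (fun i => defset phi (bs i)))].

End Dividing.

Arguments NTP2 {L} C.

Section KeislerMeasures.
Variables (R : realType) (L : language) (C : structure L) (n : nat).

(* Only the values of [mu] on A-definable sets matter. *)
Definition keisler_measure (A : set C) (mu : set ('I_n -> C) -> R) : Prop :=
  [/\ forall D, definable A D -> 0 <= mu D,
      mu setT = 1 &
      forall D E, definable A D -> definable A E -> D `&` E = set0 ->
        mu (D `|` E) = mu D + mu E].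

(* [nu] extends the measure [mu] over [A]. *)
Definition extends (A : set C) (mu nu : set ('I_n -> C) -> R) : Prop :=
  forall D, definable A D -> nu D = mu D.

Definition NTP2_smooth (A : set C) (mu : set ('I_n -> C) -> R) : Prop :=
  forall (B : set C) (nu : set ('I_n -> C) -> R),
    A `<=` B -> keisler_measure B nu -> extends A mu nu ->
    forall (m : nat) (phi : formula L ('I_n + 'I_m)) (b : 'I_m -> C),
      (forall j, B (b j)) -> divides A phi b -> nu (defset phi b) = 0.

End KeislerMeasures.

(* Main.v *)
(**
Keisler measures are extended to finitely additive probabilities on all subsets
of C^n. Fix phi, k and eps, and suppose that no extension of mu by finitely many
parameters prevents its further extensions from giving measure at least eps to
instances of phi that k-divide over the parameters. Starting with such an
instance phi(x, b), where b = b_0 and (b_j) witnesses dividing over A_i,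
averaging the extension over automorphisms fixing A_i and carrying b_0 to b_j,
j < w, gives mu_(i+1) with

   mu_(i+1)(D & phi(x, b_j)) >= la_i(D) / w   for D definable over A_i,

where la_i(D) is the former measure of D & phi(x, b_0). Let mu and la be limits
of mu_i and la_i along an ultrafilter. An approximate Hahn decomposition yields
a definable D0 on whose definable subsets la is at least (eps / 2) mu up to a
small error, so that la(G & phi(x, b^i_j)) is at least about (eps / 2w) la(G)
for suitable large i. Hence rows i can be selected one after the other so that
all paths through the array (b^i_j) of width w are consistent, and by
compactness phi has TP2.

So each triple (phi, k, eps) can be dealt with by adding finitely many
parameters, and this is preserved by further extensions. Zorn's lemma treats all
triples, with at most |M| + |L| + aleph_0 parameters, and a Skolem hull of these
is the required model N.
*)

From mathcomp Require Import all_boot all_order all_algebra.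
From mathcomp Require Import all_classical all_reals.
From mathcomp Require Import topology normedtype.
From mathcomp Require Import ring lra.
Require Import Defs.

Set Implicit Arguments.
Unset Strict Implicit.
Unset Printing Implicit Defensive.

Local Open Scope classical_set_scope.
Local Open Scope ring_scope.

Import Order.TTheory GRing.Theory Num.Theory.
Import numFieldNormedType.Exports.

(** * Cardinal arithmetic *)

Lemma Zorn_preorder_on T (P : set T) (le : T -> T -> Prop) :
  P !=set0 -> (forall x, le x x) ->
  (forall x y z, le x y -> le y z -> le x z) ->
  (forall F : set T, F !=set0 -> F `<=` P -> total_on F le ->
     exists2 y, P y & forall x, F x -> le x y) ->
  exists2 x, P x & forall y, P y -> le x y -> le y x.
Proof.
move=> [x0 Px0] le_refl le_trans chain_ub.
have [||F tF|[x Px] x_max] := @ZL_preorder {x | P x} (exist _ x0 Px0)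
    (fun x y => `[< le (sval x) (sval y) >]).
- by move=> x; exact/asboolP.
- by move=> y x z /asboolP xy /asboolP yz; apply/asboolP; exact: le_trans yz.
- have [->|/set0P[y Fy]] := eqVneq F set0; first by exists (exist _ x0 Px0).
  have [|||z Pz z_ub] := chain_ub (sval @` F).
  + by exists (sval y), y.
  + by move=> _ [x _ <-]; exact: svalP.
  + move=> _ _ [x Fx <-] [x' Fx' <-].
    by have [/asboolP|/asboolP] := tF _ _ Fx Fx'; [left|right].
  + by exists (exist _ z Pz) => x Fx; apply/asboolP/z_ub; exists x.
exists x => // y Py xy; exact/asboolP/(x_max (exist _ y Py) (asboolT xy)).
Qed.

Section Cardinals.
Local Open Scope card_scope.

Lemma card_le_fun T U (A : set T) (B : set U) (f : T -> U) :
  set_fun A B f -> set_inj A f -> A #<= B.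
Proof.
move=> fAB finj; have : exists2 g, set_fun A B g & set_inj A g by exists f.
by move/injfunPex => [g]; exact: inj_card_le.
Qed.

Lemma card_le_inj T U (f : T -> U) : injective f -> [set: T] #<= [set: U].
Proof. by move=> finj; apply: (@card_le_fun _ _ _ _ f) => // x y _ _ /finj. Qed.

Lemma card_le_rel T U (A : set T) (B : set U) (r : T -> U -> Prop) :
  (forall x, A x -> exists2 y, B y & r x y) ->
  (forall x x' y, A x -> A x' -> r x y -> r x' y -> x = x') -> A #<= B.
Proof.
move=> r_total r_inj; have [->|/set0P[x0 Ax0]] := eqVneq A set0.
  exact: card_ge0.
have [y0 _ _] := r_total x0 Ax0.
have /choice[f fP] x : exists y, A x -> B y /\ r x y.
  have [Ax|NAx] := pselect (A x); last by exists y0.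
  by have [y By rxy] := r_total x Ax; exists y.
apply: (@card_le_fun _ _ _ _ f) => [x /fP[]//|x x'].
move=> /set_mem Ax /set_mem Ax' fxx'.
by apply: (r_inj x x' (f x)) => //; [case: (fP x)|rewrite fxx'; case: (fP x')].
Qed.

Lemma card_le_funP T U (A : set T) (B : set U) : B !=set0 ->
  A #<= B <-> exists2 f : T -> U, set_fun A B f & set_inj A f.
Proof.
case=> b Bb; split=> [/card_leP[f]|[f]]; last exact: card_le_fun.
have fE (x : T) : exists y : U, forall Ax : x \in A, y = val (f (SigSub Ax)).
  have [Ax|NAx] := pselect (x \in A); last by exists b => Ax; case: NAx.
  by exists (val (f (SigSub Ax))) => Ax'; congr (val (f _)); exact: val_inj.
have [g gE] := choice fE; exists g => [x Ax|x y Ax Ay].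
  by rewrite (gE x (mem_set Ax)); exact: set_mem (valP _).
rewrite (gE x Ax) (gE y Ay) => /val_inj fxy.
by have [] := inj (mem_set (I : [set: A] _)) (mem_set (I : [set: A] _)) fxy.
Qed.

Lemma card_le_total T U (A : set T) (B : set U) : A #<= B \/ B #<= A.
Proof.
pose matching (G : set (T * U)) := G `<=` A `*` B /\
  forall p q, G p -> G q -> p.1 = q.1 <-> p.2 = q.2.
have [F Fm tF|G [[GAB Gm] Gmax]] := @Zorn_bigcup _ matching.
  split=> [p [G /Fm[GAB _]]|p q [G FG Gp] [J FJ Jq]]; first exact: GAB.
  have [GJ|JG] := tF _ _ FG FJ.
    by apply: (Fm _ FJ).2 => //; exact: GJ.
  by apply: (Fm _ FG).2 => //; exact: JG.
have [dG|/existsNP[x /not_implyP[Ax Nx]]] :=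
    pselect (forall x, A x -> exists y, G (x, y)).
  left; apply: (@card_le_rel _ _ _ _ (fun x y => G (x, y))).
    by move=> x /dG[y Gxy]; exists y; case: (GAB _ Gxy).
  by move=> x x' y _ _ Gx Gx'; exact/(Gm _ _ Gx Gx').
have [rG|/existsNP[y /not_implyP[By Ny]]] :=
    pselect (forall y, B y -> exists x, G (x, y)).
  right; apply: (@card_le_rel _ _ _ _ (fun y x => G (x, y))).
    by move=> z /rG[v Gvz]; exists v; case: (GAB _ Gvz).
  by move=> z z' v _ _ Gz Gz'; exact/(Gm _ _ Gz Gz').
exfalso; apply: (Gmax (G `|` [set (x, y)])).
  split=> [|/(_ (x, y)) Gxy]; first exact: subsetUl.
  by apply: Nx; exists y; apply: Gxy; right.
split=> [p [/GAB//|->//]|[x1 y1] [x2 y2] [G1|[-> ->]] [G2|[-> ->]] //=].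
- exact: Gm G1 G2.
- by split=> [xE|yE]; exfalso;
    [apply: Nx; exists y1; rewrite -xE|apply: Ny; exists x1; rewrite -yE].
- by split=> [xE|yE]; exfalso;
    [apply: Nx; exists y2; rewrite xE|apply: Ny; exists x2; rewrite yE].
Qed.

Lemma card_setX_mono T T' U U' (A : set T) (A' : set T') (B : set U)
    (B' : set U') :
  A #<= B -> A' #<= B' -> A `*` A' #<= B `*` B'.
Proof.
have [->|/set0P[b Bb]] := eqVneq B set0.
  by move=> /card_le0P -> _; rewrite set0X card_ge0.
have [->|/set0P[b' Bb']] := eqVneq B' set0.
  by move=> _ /card_le0P ->; rewrite setX0 card_ge0.
move=> /card_le_funP[|f fAB finj]; first by exists b.
move=> /card_le_funP[|f' fAB' finj']; first by exists b'.
apply: (@card_le_fun _ _ _ _ (fun p => (f p.1, f' p.2))).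
  by move=> p [/fAB ? /fAB' ?].
move=> [x x'] [y y'] /set_mem[/= /mem_set Ax /mem_set Ax'].
by move=> /set_mem[/= /mem_set Ay /mem_set Ay'] [/finj -> // /finj' ->].
Qed.

Lemma patch_set_fun T U (A Z : set T) (P Q : set U) (f g : T -> U) :
  set_fun A P f -> set_fun (Z `\` A) Q g -> set_fun Z (P `|` Q) (patch g A f).
Proof.
move=> fP gQ z Zz; rewrite /patch; case: ifPn => [/set_mem/fP|]; first by left.
by move=> /negP NAz; right; apply: gQ; split=> // /mem_set.
Qed.

Lemma patch_set_inj T U (A Z : set T) (P Q : set U) (f g : T -> U) :
  set_fun A P f -> set_inj A f -> set_fun (Z `\` A) Q g ->
  set_inj (Z `\` A) g -> P `&` Q = set0 -> set_inj Z (patch g A f).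
Proof.
move=> fP finj gQ ginj PQ y z Zy Zz.
have NA x : x \in Z -> x \notin A -> x \in Z `\` A.
  by move=> Zx NAx; rewrite in_setD Zx.
have disj u : P u -> Q u -> False.
  by move=> Pu Qu; have : (P `&` Q) u by []; rewrite PQ.
rewrite /patch; case: ifPn => Ay; case: ifPn => Az.
- exact: finj.
- by move=> fg; case: (disj (f y)); [|rewrite fg];
    [exact/fP/set_mem|exact/gQ/set_mem/NA].
- by move=> gf; case: (disj (f z)); [|rewrite -gf];
    [exact/fP/set_mem|exact/gQ/set_mem/NA].
- by apply: ginj; exact: NA.
Qed.

Lemma card_setU_le_setX T U (A B : set T) (D : set U) :
  infinite_set D -> A #<= D -> B #<= D -> A `|` B #<= D `*` D.
Proof.
move=> Dinf AD BD; have [d Dd] := infinite_setN0 Dinf.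
have [d' [Dd' d'd]] : D `\` [set d] !=set0.
  by apply/infinite_setN0/infinite_setD => //; exact: finite_set1.
have D0 : D !=set0 by exists d.
have [f fD finj] := (card_le_funP A D0).1 AD.
have [g gD ginj] := (card_le_funP B D0).1 BD.
have fun_f : set_fun A ([set d] `*` D) (fun x => (d, f x)).
  by move=> x Ax; split=> //; exact: fD.
have fun_g : set_fun ((A `|` B) `\` A) ([set d'] `*` D) (fun x => (d', g x)).
  by move=> x [[//|Bx] _]; split=> //; exact: gD.
have DD : [set d] `*` D `|` [set d'] `*` D `<=` D `*` D.
  by move=> [u v] [] [/= -> Dv].
apply: (card_le_fun (f := patch (fun x => (d', g x)) A (fun x => (d, f x)))).
  by move=> x /(patch_set_fun fun_f fun_g)/DD.
apply: patch_set_inj fun_f _ fun_g _ _.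
- by move=> x y Ax Ay [/finj]; exact.
- rewrite setDUl setDv set0U => x y /set_mem[Bx _] /set_mem[By _] [].
  by apply: ginj; exact: mem_set.
- by apply/seteqP; split=> // -[u v] [[/= -> _] [/= dd' _]]; case: d'd.
Qed.

Section Pairing.
Variables (T : Type) (B : set T).

Definition partial_pairing (p : set T * (T * T -> T)) : Prop :=
  [/\ infinite_set p.1, p.1 `<=` B, set_fun (p.1 `*` p.1) p.1 p.2 &
      set_inj (p.1 `*` p.1) p.2].

Definition pairing_le (p q : set T * (T * T -> T)) : Prop :=
  p.1 `<=` q.1 /\ forall z, (p.1 `*` p.1) z -> p.2 z = q.2 z.

Lemma ex_partial_pairing : infinite_set B -> exists p, partial_pairing p.
Proof.
move=> Binf; have B0 := infinite_setN0 Binf.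
have [e eB einj] := (card_le_funP _ B0).1 ((infiniteP B).1 Binf).
have Ainf : infinite_set (range e).
  by apply/infiniteP; apply: (@card_le_fun _ _ _ _ e) => // x; exists x.
have Acount : countable (range e) by exact: card_image_le.
have [|f fA finj] :=
    (card_le_funP (range e `*` range e) (infinite_setN0 Ainf)).1.
  by apply: card_le_trans (countableX Acount Acount) _; exact/infiniteP.
by exists (range e, f); split=> // _ [i _ <-]; exact: eB.
Qed.

Lemma partial_pairing_chain (F : set (set T * (T * T -> T))) :
  F !=set0 -> F `<=` partial_pairing -> total_on F pairing_le ->
  exists2 p, partial_pairing p & forall q, F q -> pairing_le q p.
Proof.
move=> [q0 Fq0] FP tF; pose A := \bigcup_(p in F) p.1.
have /choice[f fE] z : exists y, forall p, F p -> (p.1 `*` p.1) z -> p.2 z = y.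
  have [[p Fp pz]|Nz] := pselect (exists2 p, F p & (p.1 `*` p.1) z).
    exists (p.2 z) => q Fq qz.
    by have [[_ ->]|[_ ->]] := tF _ _ Fp Fq.
  by exists z.1 => p Fp pz; case: Nz; exists p.
have AE z : (A `*` A) z -> exists2 p, F p & (p.1 `*` p.1) z.
  move=> [[p Fp pz] [q Fq qz]].
  have [[pq _]|[qp _]] := tF _ _ Fp Fq.
    by exists q => //; split=> //; exact: pq.
  by exists p => //; split=> //; exact: qp.
exists (A, f); last by move=> q Fq; split=> [x qx|z /(fE z _ Fq)//]; exists q.
have [q0inf _ _ _] := FP _ Fq0.
split=> /=.
- by apply: sub_infinite_set q0inf => x q0x; exists q0.
- by move=> x [p /FP[_ pB _ _]]; exact: pB.
- move=> z /AE[p Fp pz]; have [_ _ pfun _] := FP _ Fp.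
  by rewrite -(fE z p)//; exists p => //; exact: pfun.
- move=> y z /set_mem/AE[p Fp py] /set_mem/AE[q Fq qz].
  have [r Fr [ry rz]] : exists2 r, F r & (r.1 `*` r.1) y /\ (r.1 `*` r.1) z.
    have [[pq _]|[qp _]] := tF _ _ Fp Fq.
      by exists q => //; split=> //; split; [exact: pq py.1|exact: pq py.2].
    by exists p => //; split=> //; split; [exact: qp qz.1|exact: qp qz.2].
  have [_ _ _ rinj] := FP _ Fr.
  by rewrite -(fE y r)// -(fE z r)//; apply: rinj; exact: mem_set.
Qed.

Lemma partial_pairing_extend p : partial_pairing p -> p.1 #<= B `\` p.1 ->
  exists q, [/\ partial_pairing q, pairing_le p q & ~ q.1 `<=` p.1].
Proof.
case: p => A f [/= Ainf AB fA finj].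
move=> AD; have [a Aa] := infinite_setN0 Ainf.
have AA : A `*` A #<= A by exact: card_le_fun fA finj.
have D0 : B `\` A !=set0.
  by apply: infinite_setN0 => /(card_le_finite AD); exact: Ainf.
have [h hD hinj] := (card_le_funP A D0).1 AD.
have hA : A #<= h @` A by apply: card_le_fun hinj => x Ax; exists x.
have UA : A `|` h @` A #<= A.
  apply: card_le_trans AA; apply: card_setU_le_setX => //.
  exact: card_image_le.
(* The new pairs are coded in [h @` A], which is disjoint from [A]. *)
have UUhA : (A `|` h @` A) `*` (A `|` h @` A) #<= h @` A.
  by apply: card_le_trans (card_setX_mono UA UA) _; exact: card_le_trans AA hA.
have [|g gh ginj] := (card_le_funP _ _).1 UUhA; first by exists (h a); exists a.
have AhA : A `&` h @` A = set0.
  apply/seteqP; split=> // x [Ax [y /hD[_ NAhy] hyx]].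
  by apply: NAhy; rewrite hyx.
pose glued := patch g (A `*` A) f.
have gh' : set_fun ((A `|` h @` A) `*` (A `|` h @` A) `\` A `*` A) (h @` A) g.
  by move=> z [/gh].
exists (A `|` h @` A, glued); split; last 2 first.
- by split=> /= [x|z /mem_set Az]; [left|rewrite /glued patchT].
- move=> /(_ (h a)) ha_A; have [_] := hD _ Aa; apply.
  by apply: ha_A; right; exists a.
split=> /=.
- by apply: sub_infinite_set Ainf; exact: subsetUl.
- by move=> x [/AB//|[y /hD[By _] <-]].
- exact: patch_set_fun fA gh'.
- apply: patch_set_inj fA finj gh' _ AhA => y z.
  by rewrite !in_setD => /andP[Uy _] /andP[Uz _]; exact: ginj.
Qed.

End Pairing.

Theorem card_setXX_le T (B : set T) : infinite_set B -> B `*` B #<= B.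
Proof.
move=> Binf.
have [||||p pP p_max] :=
    @Zorn_preorder_on _ (partial_pairing B) (@pairing_le T).
- exact: ex_partial_pairing.
- by move=> p; split.
- move=> p q r [pq pqE] [qr qrE]; split=> [|z pz]; first exact: subset_trans qr.
  by rewrite pqE// qrE//; split; [exact: pq pz.1|exact: pq pz.2].
- exact: partial_pairing_chain.
have [Ainf AB fA finj] := pP; have AA := card_le_fun fA finj.
have [DA|AD] := card_le_total (B `\` p.1) p.1; last first.
  have [q [qP pq qp]] := partial_pairing_extend pP AD.
  by case: qp; case: (p_max q qP pq).
have BA : B #<= p.1.
  rewrite -(setUIDK B p.1) (setIidr AB); apply: card_le_trans AA.
  by apply: card_setU_le_setX => //; exact: card_lexx.
apply: card_le_trans (card_setX_mono BA BA) _; apply: card_le_trans AA _.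
exact: subset_card_le.
Qed.

Lemma setT_sum T T' : [set: T + T'] = inl @` [set: T] `|` inr @` [set: T'].
Proof.
by apply/seteqP; split=> // -[x|y] _; [left; exists x|right; exists y].
Qed.

Section InfiniteBound.
Variables (U : Type) (D : set U).
Hypothesis Dinf : infinite_set D.

Lemma card_le_setX T T' (A : set T) (B : set T') :
  A #<= D -> B #<= D -> A `*` B #<= D.
Proof.
move=> AD BD; apply: card_le_trans (card_setX_mono AD BD) _.
exact: card_setXX_le.
Qed.

Lemma card_le_setU T (A B : set T) : A #<= D -> B #<= D -> A `|` B #<= D.
Proof.
move=> AD BD; apply: card_le_trans (card_setU_le_setX Dinf AD BD) _.
exact: card_setXX_le.
Qed.

Lemma card_le_bigcup I T (J : set I) (F : I -> set T) :
  J #<= D -> (forall i, J i -> F i #<= D) -> \bigcup_(i in J) F i #<= D.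
Proof.
move=> JD FD; have D0 := infinite_setN0 Dinf; have [d Dd] := D0.
have /choice[g gP] i : exists g, J i -> set_fun (F i) D g /\ set_inj (F i) g.
  have [Ji|NJi] := pselect (J i); last by exists (fun=> d).
  by have [g gF ginj] := (card_le_funP _ D0).1 (FD i Ji); exists g.
apply: card_le_trans (card_le_setX JD (card_lexx D)).
apply: (@card_le_rel _ _ _ _ (fun x p => [/\ J p.1, F p.1 x & g p.1 x = p.2])).
  move=> x [i Ji Fx]; exists (i, g i x) => //.
  by split=> //; exact: (gP i Ji).1.
move=> x x' [i y] _ _ /= [Ji Fx <-] [_ Fx' /esym].
by apply: (gP i Ji).2; exact: mem_set.
Qed.

Lemma card_le_sum T T' :
  [set: T] #<= D -> [set: T'] #<= D -> [set: T + T'] #<= D.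
Proof.
move=> TD T'D; rewrite setT_sum; apply: card_le_setU.
  by apply: card_le_trans TD; exact: card_image_le.
by apply: card_le_trans T'D; exact: card_image_le.
Qed.

Lemma card_le_sigT I (P : I -> Type) : [set: I] #<= D ->
  (forall i, [set: P i] #<= D) -> [set: {i & P i}] #<= D.
Proof.
move=> ID PD; have -> : [set: {i & P i}] = \bigcup_i (existT P i @` [set: P i]).
  by apply/seteqP; split=> // -[i x] _; exists i => //; exists x.
apply: card_le_bigcup => // i _; apply: card_le_trans (PD i).
exact: card_image_le.
Qed.

Lemma card_le_seq T : [set: T] #<= D -> [set: seq T] #<= D.
Proof.
move=> TD; have [d Dd] := infinite_setN0 Dinf.
have -> : [set: seq T] = \bigcup_n [set s | size s = n].
  by apply/seteqP; split=> // s _; exists (size s).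
apply: card_le_bigcup => [|n _]; first exact/infiniteP.
elim: n => [|n IH].
  apply: (@card_le_fun _ _ _ _ (fun=> d)) => // s s' /set_mem/size0nil ->.
  by move=> /set_mem/size0nil ->.
apply: card_le_trans (card_le_setX TD IH).
apply: (@card_le_rel _ _ _ _ (fun s p => s = p.1 :: p.2)).
  by case=> [|x s] //= [sn]; exists (x, s).
by move=> s s' p _ _ -> ->.
Qed.

Lemma card_le_tree T : [set: T] #<= D -> [set: GenTree.tree T] #<= D.
Proof.
move=> TD; apply: card_le_trans (card_le_inj (pcan_inj (GenTree.codeK T))) _.
by apply/card_le_seq/card_le_sum => //; exact/infiniteP.
Qed.

End InfiniteBound.

Lemma card_lt_nat_infinite T (D : set T) :
  card_lt [set: nat] D -> infinite_set D.
Proof. by move=> Dnat /finite_set_countable. Qed.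

Lemma card_lt_finite T U (A : set T) (D : set U) :
  infinite_set D -> finite_set A -> card_lt A D.
Proof. by move=> Dinf Afin /card_le_finite/(_ Afin). Qed.

Lemma card_lt_setU T U (A B : set T) (D : set U) :
  infinite_set D -> card_lt A D -> card_lt B D -> card_lt (A `|` B) D.
Proof.
move=> Dinf; wlog AB : A B / A #<= B => [wlog_AB|AD BD DAB].
  have [AB|BA] := card_le_total A B; first exact: wlog_AB.
  by move=> AD BD; rewrite setUC; exact: wlog_AB.
have [Bfin|Binf] := pselect (finite_set B); last first.
  by apply/BD/(card_le_trans DAB)/card_le_setU => //; exact: card_lexx.
have Afin := card_le_finite AB Bfin.
by move: DAB; apply: card_lt_finite => //; rewrite finite_setU.
Qed.

Lemma card_lt_sum T T' U (D : set U) : infinite_set D ->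
  card_lt [set: T] D -> card_lt [set: T'] D -> card_lt [set: T + T'] D.
Proof.
move=> Dinf TD T'D; rewrite setT_sum.
by apply: card_lt_setU => // /card_le_trans/(_ (card_image_le _ _)).
Qed.

End Cardinals.

(** * Finitely additive measures *)

Section Ultrafilters.

Lemma fmap_ultra T U (F : set_system T) (f : T -> U) :
  UltraFilter F -> UltraFilter (f x @[x --> F]).
Proof.
move=> FU; split=> [|G GF FG]; first exact: fmap_proper_filter.
apply/seteqP; split=> [A GA|]; last exact: FG.
have [//|FCA] := in_ultra_setVsetC (f @^-1` A) FU.
by have [x []] := filter_ex (filterI GA (FG (~` A) FCA)).
Qed.

Lemma ultra_is_cvg (R : realType) T (F : set_system T) (f : T -> R) (a b : R) :
  UltraFilter F -> (forall x, a <= f x <= b) -> cvg (f x @[x --> F]).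
Proof.
move=> FU fab; have fF : \forall x \near F, f x \in `[a, b].
  by apply: nearW => x; rewrite in_itv /=.
have := @segment_compact R a b; rewrite compact_ultra.
by move=> /(_ _ (fmap_ultra f FU) fF)[y [_ fy]]; apply/cvg_ex; exists y.
Qed.

Lemma near_in_seq T (I : eqType) (F : set_system T) {FF : Filter F}
    (P : I -> T -> Prop) (s : seq I) :
  {in s, forall i, \forall x \near F, P i x} ->
  \forall x \near F, {in s, forall i, P i x}.
Proof.
elim: s => [_|i s IH sP]; first by apply: filterS filterT => x _ i.
have Pi : \forall x \near F, P i x by apply: sP; rewrite mem_head.
have Ps : \forall x \near F, {in s, forall j, P j x}.
  by apply: IH => j js; apply: sP; rewrite inE js orbT.
apply: filterS (filterI Pi Ps) => x [Pix Psx] j.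
by rewrite inE => /predU1P[->|/Psx].
Qed.

End Ultrafilters.

Definition algebra_of_sets X (B : set (set X)) : Prop :=
  [/\ B setT, setI_closed B & forall D, B D -> B (~` D)].

Lemma algebra_of_setsD X (B : set (set X)) D E :
  algebra_of_sets B -> B D -> B E -> B (D `\` E).
Proof.
by move=> [_ BI BC] BD BE; rewrite setDE; apply: BI => //; exact: BC.
Qed.

Lemma algebra_of_sets_bigcup X (B : nat -> set (set X)) :
  (forall i, algebra_of_sets (B i)) ->
  {homo B : i j / (i <= j)%N >-> i `<=` j} ->
  algebra_of_sets (\bigcup_i B i).
Proof.
move=> Balg Bmono; split=> [|D E [i _ BiD] [j _ BjE]|D [i _ BiD]].
- by exists 0%N => //; case: (Balg 0%N).
- have [_ BI _] := Balg (maxn i j); exists (maxn i j) => //; apply: BI.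
    by apply: Bmono BiD; exact: leq_maxl.
  by apply: Bmono BjE; exact: leq_maxr.
- by have [_ _ BC] := Balg i; exists i => //; exact: BC.
Qed.

Section FinitelyAdditive.
Variables (R : realType) (X : Type).
Implicit Types (mu nu : set X -> R) (D E : set X) (B : set (set X)).

Definition fa_measure mu : Prop :=
  (forall D, 0 <= mu D) /\
  (forall D E, D `&` E = set0 -> mu (D `|` E) = mu D + mu E).

Definition fa_probability mu : Prop := fa_measure mu /\ mu setT = 1.

Lemma fa_measureID mu D E : fa_measure mu ->
  mu D = mu (D `&` E) + mu (D `\` E).
Proof.
move=> [_ <-]; first by rewrite setUIDK.
by rewrite setDE setIACA setICr setI0.
Qed.

Lemma fa_measure0 mu : fa_measure mu -> mu set0 = 0.
Proof.
by move=> mum; have := fa_measureID set0 set0 mum; rewrite set0I set0D; lra.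
Qed.

Lemma fa_measure_le mu D E : fa_measure mu -> D `<=` E -> mu D <= mu E.
Proof.
move=> mum DE; rewrite (fa_measureID E D mum) (setIidr DE).
by have := mum.1 (E `\` D); lra.
Qed.

Lemma fa_probability01 mu D : fa_probability mu -> 0 <= mu D <= 1.
Proof. by move=> [mum <-]; rewrite mum.1 /=; exact: fa_measure_le. Qed.

Lemma fa_measure_scale mu (c : R) :
  0 <= c -> fa_measure mu -> fa_measure (fun D => c * mu D).
Proof.
move=> c0 mum; split=> [D|D E DE]; first by rewrite mulr_ge0// mum.1.
by rewrite mum.2// mulrDr.
Qed.

Lemma fa_measure_sum (I : finType) (mu : I -> set X -> R) :
  (forall i, fa_measure (mu i)) -> fa_measure (fun D => \sum_i mu i D).
Proof.
move=> mum; split=> [D|D E DE].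
  by apply: sumr_ge0 => i _; exact: (mum i).1.
by rewrite -big_split; apply: eq_bigr => i _; exact: (mum i).2.
Qed.

Lemma fa_measureD mu nu :
  fa_measure mu -> fa_measure nu -> fa_measure (fun D => mu D + nu D).
Proof.
move=> mum num; split=> [D|D E DE]; first by rewrite addr_ge0 ?mum.1 ?num.1.
by rewrite mum.2// num.2// addrACA.
Qed.

Lemma fa_measure_point (x : X) (a : R) :
  0 <= a -> fa_measure (fun D => if x \in D then a else 0).
Proof.
move=> a0; split=> [D|D E DE]; first by case: ifP.
rewrite in_setU; case: (boolP (x \in D)) => [xD|xND] /=; last by rewrite add0r.
rewrite ifF ?addr0//; apply/negbTE/negP => xE.
have : (D `&` E) x by split; exact: set_mem.
by rewrite DE.
Qed.

Lemma fa_measure_restrict mu F :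
  fa_measure mu -> fa_measure (fun D => mu (D `&` F)).
Proof.
move=> mum; split=> [D|D E DE]; first exact: mum.1.
by rewrite setIUl mum.2// setIACA DE set0I.
Qed.

Lemma fa_measure_lim I (U : set_system I) (mu : I -> set X -> R) (r : R) :
  UltraFilter U -> (forall i, fa_measure (mu i)) ->
  (forall i, mu i setT <= r) ->
  fa_measure (fun D => lim (mu i D @[i --> U])).
Proof.
move=> UU mum mur; have mu_cvg D : cvg (mu i D @[i --> U]).
  apply: (ultra_is_cvg (a := 0) (b := r)) => i.
  by rewrite (mum i).1 /= (le_trans _ (mur i))//; exact: fa_measure_le.
split=> [D|D E DE].
  by apply: limr_ge => //; apply: nearW => i; exact: (mum i).1.
by rewrite -limD//; congr (lim (_ @ U)); apply/funext => i; exact: (mum i).2.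
Qed.

Lemma fa_probability_lim I (U : set_system I) (mu : I -> set X -> R) :
  UltraFilter U -> (forall i, fa_probability (mu i)) ->
  fa_probability (fun D => lim (mu i D @[i --> U])).
Proof.
move=> UU mup; split.
  by apply: (fa_measure_lim (r := 1)) => i; case: (mup i) => // _ ->.
by apply: lim_near_cst => //; apply: nearW => i; case: (mup i).
Qed.

Lemma fa_probability_compact (P : set (set X * R)) :
  (forall s : seq (set X * R), [set` s] `<=` P ->
     exists2 nu, fa_probability nu & {in s, forall p, nu p.1 = p.2}) ->
  exists2 nu, fa_probability nu & forall p, P p -> nu p.1 = p.2.
Proof.
move=> Pfin.
pose cone (l : seq (set X * R)) := [set s : seq (set X * R) | {subset l <= s}].
have cone_proper : ProperFilter (filter_from setT cone).
  apply: filter_from_proper; last by move=> l _; exists l.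
  apply: filter_from_filter; first by exists [::].
  move=> l l' _ _; exists (l ++ l') => // s ll's.
  by split=> p pl; apply: ll's; rewrite mem_cat pl ?orbT.
have [U [UU coneU]] := ultraFilterLemma cone_proper.
have /choice[nu nuP] (s : seq (set X * R)) : exists nu, fa_probability nu /\
    {in s, forall p, P p -> nu p.1 = p.2}.
  have [p /=|nu nup nuE] := Pfin [seq p <- s | `[< P p >]].
    by rewrite mem_filter => /andP[/asboolP].
  exists nu; split=> // p ps Pp; apply: nuE.
  by rewrite mem_filter ps andbT; exact/asboolP.
exists (fun D => lim (nu s D @[s --> U])).
  by apply: fa_probability_lim => s; case: (nuP s).
move=> p Pp; apply: lim_near_cst => //; apply: coneU; exists [:: p] => // s ps.
by apply: (nuP s).2 => //; apply: ps; rewrite mem_head.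
Qed.

Section Extension.
Variables (B : set (set X)) (mu : set X -> R).
Hypotheses (Balg : algebra_of_sets B) (mu_ge0 : forall D, B D -> 0 <= mu D)
  (muD : forall D E, B D -> B E -> D `&` E = set0 ->
    mu (D `|` E) = mu D + mu E).

Let muID D E : B D -> B E -> mu D = mu (D `&` E) + mu (D `\` E).
Proof.
move=> BD BE; rewrite -muD ?setUIDK//.
- by case: Balg => _ BI _; exact: BI.
- exact: algebra_of_setsD.
- by rewrite setDE setIACA setICr setI0.
Qed.

Let mu_set0 : mu set0 = 0.
Proof.
have B0 : B set0 by case: Balg => BT _ BC; rewrite -setCT; exact: BC.
by have := muID B0 B0; rewrite set0I set0D; lra.
Qed.

(* [nu] is a sum of point masses, one in each atom of the algebra generated by
   [A] and [l]. *)
Lemma fa_extension_finite (l : seq (set X)) (A : set X) : B A ->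
  [set` l] `<=` B ->
  exists nu, [/\ fa_measure nu, nu setT = mu A, forall E, nu (E `&` A) = nu E &
                 {in l, forall D, nu D = mu (A `&` D)}].
Proof.
have [_ BI _] := Balg.
elim: l A => [|D l IH] A BA lB.
  have [->|/set0P[x Ax]] := eqVneq A set0.
    exists (fun D => 0); split; rewrite ?mu_set0//.
    by split=> // D E _; rewrite addr0.
  exists (fun D => if x \in D then mu A else 0); split=> //.
  - by apply: fa_measure_point; exact: mu_ge0.
  - by rewrite in_setT.
  - by move=> E; rewrite in_setI (mem_set Ax) andbT.
have BD : B D by apply: lB; rewrite /= mem_head.
have {}lB : [set` l] `<=` B by move=> E lE; apply: lB; rewrite /= inE lE orbT.
have [nu1 [nu1m nu1T nu1A nu1l]] := IH _ (BI _ _ BA BD) lB.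
have [nu2 [nu2m nu2T nu2A nu2l]] := IH _ (algebra_of_setsD Balg BA BD) lB.
exists (fun E => nu1 E + nu2 E); split.
- exact: fa_measureD.
- by rewrite nu1T nu2T -muID.
- move=> E; congr (_ + _).
    by rewrite -[LHS]nu1A -[RHS]nu1A -setIA (setIA A) setIid.
  by rewrite -[LHS]nu2A -[RHS]nu2A setDE -setIA (setIA A) setIid.
move=> E; rewrite inE => /predU1P[->|lE].
  rewrite -nu1A -(nu2A D) -[RHS]addr0; congr (_ + _).
    by rewrite setICA setIid -nu1T -[RHS]nu1A setTI.
  by rewrite setDE setICA setICr setI0 fa_measure0.
rewrite nu1l// nu2l// [RHS](@muID _ D)//; last by apply: BI => //; exact: lB.
by rewrite !setDE; congr (mu _ + mu _); exact: setIAC.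
Qed.

Lemma fa_extension : mu setT = 1 ->
  exists2 nu, fa_probability nu & forall D, B D -> nu D = mu D.
Proof.
move=> mu1; have [BT _ _] := Balg.
have [s sP|nu nup nuP] :=
    @fa_probability_compact [set p | B p.1 /\ p.2 = mu p.1].
  have [|nu [num nuT _ nuE]] := @fa_extension_finite (map fst s) setT BT.
    by move=> _ /mapP[p /sP[Bp _] ->].
  exists nu => [|p ps]; first by split; rewrite // nuT.
  by rewrite nuE ?setTI ?map_f// (sP p ps).2.
by exists nu => // D BD; exact: (nuP (D, mu D)).
Qed.

End Extension.

Lemma approx_hahn B mu nu (e : R) :
  algebra_of_sets B -> fa_measure mu -> fa_measure nu -> 0 < e ->
  exists D0, [/\ B D0, nu setT - mu setT <= nu D0 - mu D0 + e &
    forall D, B D -> D `<=` D0 -> mu D <= nu D + e].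
Proof.
move=> Balg mum num e0; have [BT _ _] := Balg.
pose gain := [set nu D - mu D | D in B].
have gain_sup : has_sup gain.
  split; first by exists (nu setT - mu setT), setT.
  exists (nu setT) => _ [D _ <-].
  by have := fa_measure_le num (@subsetT _ D); have := mum.1 D; lra.
have [_ [D0 BD0 <-] D0gain] := sup_adherent e0 gain_sup.
have D0max D : B D -> nu D - mu D <= nu D0 - mu D0 + e.
  move=> BD; suff : nu D - mu D <= sup gain by lra.
  by apply: sup_upper_bound => //; exists D.
exists D0; split=> [//||D BD DD0]; first exact: D0max.
(* Removing [D] from [D0] cannot increase [nu - mu] by more than [e]. *)
have := D0max _ (algebra_of_setsD Balg BD0 BD).
rewrite (fa_measureID D0 D mum) (fa_measureID D0 D num) (setIidr DD0).
by lra.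
Qed.

End FinitelyAdditive.

Lemma fa_measure_preimage (R : realType) X Y (mu : set X -> R) (f : X -> Y) :
  fa_measure mu -> fa_measure (fun D => mu (f @^-1` D)).
Proof.
move=> mum; split=> [D|D E DE]; first exact: mum.1.
by rewrite preimage_setU mum.2// -preimage_setI DE preimage_set0.
Qed.

(** * Consistent paths through an array of large sets *)

Section Paths.
Variables (R : realType) (X : Type).
Implicit Types (mu la : set X -> R) (B : set (set X)) (E : nat -> nat -> set X).

Definition consistent_paths E (w N : nat) : Prop :=
  exists h : nat -> nat, forall eta : nat -> nat, (forall l, (eta l < w)%N) ->
    exists x, forall l, (l < N)%N -> E (h l) (eta l) x.

(* [la G] stands for the measure of the intersection of [G] with the first set
   of a late row. *)
Definition large_rows B mu la E (w : nat) : Prop :=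
  forall (Gs : seq (set X)) (d : R), [set` Gs] `<=` B -> 0 < d ->
  exists i, {in Gs, forall G, forall j, (j < w)%N ->
    B (G `&` E i j) /\ (la G - d) / w%:R <= mu (G `&` E i j)}.

(* On subsets of [D0] the measure [la] dominates a multiple of [mu], hence each
   row of the path divides the lower bound on [la] by at most [1 / q]. *)
Lemma large_rows_paths_from B mu la E (w : nat) (D0 : set X) (q d : R) :
  (0 < w)%N -> 0 < d -> 0 < q -> q <= 1 / 2 -> fa_measure la ->
  large_rows B mu la E w ->
  (forall D, B D -> D `<=` D0 -> 2 * w%:R * q * mu D <= la D + d) ->
  forall (k : nat) (Gs : seq (set X)),
  {in Gs, forall G, [/\ B G, G `<=` D0 & 2 * d <= q ^+ k * la G]} ->
  exists h : nat -> nat, forall eta : nat -> nat, (forall l, (eta l < w)%N) ->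
    {in Gs, forall G, exists2 x, G x &
      forall l, (l < k)%N -> E (h l) (eta l) x}.
Proof.
move=> w0 d0 q0 q2 lam rows D0P; elim=> [Gs GsP|k IH Gs GsP].
  exists id => eta _ G /GsP[_ _]; rewrite expr0 mul1r => laG.
  have [G0|/set0P[x Gx]] := eqVneq G set0; last by exists x.
  by move: laG; rewrite G0 fa_measure0//; lra.
have [G /GsP[]//|i iP] := rows Gs d _ d0.
have [_ /allpairsP[[G j] /= [GGs + ->]]|h hP] :=
    IH [seq G `&` E i j | G <- Gs, j <- iota 0 w].
  rewrite mem_iota add0n => jw.
  have [BG GD0 laG] := GsP _ GGs; have [BGE muGE] := iP _ GGs _ jw.
  have GED0 : G `&` E i j `<=` D0 by move=> x [/GD0].
  split=> //; have wn0 : 0 < w%:R :> R by rewrite ltr0n.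
  have la_step : 2 * q * (la G - d) <= la (G `&` E i j) + d.
    apply: le_trans (D0P _ BGE GED0).
    have -> F : 2 * w%:R * q * mu F = 2 * q * (mu F * w%:R) by ring.
    by rewrite ler_pM2l ?mulr_gt0// -ler_pdivrMr.
  have qlaG : 2 * d <= q * la G.
    apply: le_trans (laG) _; rewrite exprSr -mulrA.
    rewrite ler_piMl ?mulr_ge0 ?lam.1 ?(ltW q0)//.
    by apply: exprn_ile1; lra.
  apply: le_trans laG _; rewrite exprSr -mulrA ler_pM2l ?exprn_gt0//.
  have : 2 * q * d <= d by rewrite ger_pMl//; lra.
  by lra.
exists (fun l => if l is l'.+1 then h l' else i) => eta etaw G GGs.
have [||x [Gx Ex] hx] := hP (eta \o succn) _ (G `&` E i (eta 0%N)).
- by move=> l; exact: etaw.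
- by apply: allpairs_f => //; rewrite mem_iota add0n etaw.
by exists x => // -[_ //|l]; exact: hx.
Qed.

Lemma large_rows_consistent_paths B mu la E (w N : nat) (eps : R) :
  (0 < w)%N -> 0 < eps -> algebra_of_sets B -> fa_probability mu ->
  fa_measure la -> eps <= la setT <= 1 -> large_rows B mu la E w ->
  consistent_paths E w N.
Proof.
move=> w0 eps0 Balg [mum mu1] lam /andP[eps_la la1] rows.
have wn1 : 1 <= w%:R :> R by rewrite ler1n.
pose q := eps / 4 / w%:R.
have q0 : 0 < q by rewrite !divr_gt0//; lra.
have wq : 2 * w%:R * q = eps / 2.
  rewrite -mulrA [w%:R * q]mulrC divfK; last by rewrite pnatr_eq0 -lt0n.
  by lra.
have q2 : q <= 1 / 2.
  have : q <= w%:R * q by rewrite ler_peMl// ltW.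
  by move: wq; rewrite -mulrA; lra.
have qN0 : 0 < q ^+ N by rewrite exprn_gt0.
have qN1 : q ^+ N <= 1 by apply: exprn_ile1; lra.
pose d := q ^+ N * (eps / 8).
have d0 : 0 < d by rewrite mulr_gt0//; lra.
have d_le : d <= eps / 8 by rewrite ler_piMl//; lra.
have wqm : fa_measure (fun D => 2 * w%:R * q * mu D).
  by apply: fa_measure_scale => //; rewrite wq; lra.
have [D0 [BD0 laD0 D0P]] := approx_hahn Balg wqm lam d0.
have laD0_ge : eps / 4 <= la D0.
  by have := wqm.1 D0; move: laD0; rewrite mu1 wq; lra.
have [G|h hP] :=
    large_rows_paths_from w0 d0 q0 q2 lam rows D0P (k := N) (Gs := [:: D0]).
  rewrite inE => /eqP ->; split=> //.
  have := ler_wpM2l (ltW qN0) laD0_ge; rewrite /d; lra.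
exists h => eta etaw; have [|x _ hx] := hP _ etaw D0; first exact: mem_head.
by exists x.
Qed.

End Paths.

Section ArrayLimit.
Variables (R : realType) (X : Type) (B : nat -> set (set X)).
Variables (mu la : nat -> set X -> R) (E : nat -> nat -> set X).
Variables (w : nat) (eps : R).
Hypotheses (Balg : forall i, algebra_of_sets (B i))
  (B_step : forall i, B i `<=` B i.+1).
Hypotheses (w_gt0 : (0 < w)%N) (eps_gt0 : 0 < eps).
Hypotheses (mup : forall i, fa_probability (mu i))
  (mu_step : forall i D, B i D -> mu i.+1 D = mu i D)
  (lam : forall i, fa_measure (la i))
  (la_bounds : forall i, eps <= la i setT <= 1).
Hypotheses (EB : forall i j, (j < w)%N -> B i.+1 (E i j))
  (mu_E : forall i j D, (j < w)%N -> B i D ->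
    la i D / w%:R <= mu i.+1 (D `&` E i j)).

Let B_mono : {homo B : i j / (i <= j)%N >-> i `<=` j}.
Proof. by apply: homo_leq => // [D//|D F G]; exact: subset_trans. Qed.

Let mu_mono i j D : (i <= j)%N -> B i D -> mu j D = mu i D.
Proof.
move=> ij BD; rewrite -(subnKC ij).
elim: (j - i)%N => [|k IH]; first by rewrite addn0.
by rewrite addnS mu_step//; exact: (B_mono (leq_addr k i) BD).
Qed.

Let la_cvg (U : set_system nat) D : UltraFilter U -> cvg (la i D @[i --> U]).
Proof.
move=> UU; apply: (ultra_is_cvg (a := 0) (b := 1)) => i; rewrite (lam i).1 /=.
by have /andP[_] := la_bounds i; apply: le_trans; exact: fa_measure_le.
Qed.

Lemma limit_large_rows (U : set_system nat) : UltraFilter U -> \oo `<=` U ->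
  large_rows (\bigcup_i B i) (fun D => lim (mu i D @[i --> U]))
    (fun D => lim (la i D @[i --> U])) E w.
Proof.
move=> UU ooU Gs d GsB d0.
have muE i D : B i D -> lim (mu k D @[k --> U]) = mu i D.
  move=> BiD; apply: lim_near_cst => //; apply: ooU.
  by exists i => // j ij; exact: mu_mono.
have near_Gs : \forall i \near U,
    {in Gs, forall G, B i G /\ lim (la k G @[k --> U]) - d <= la i G}.
  apply: near_in_seq => G /GsB[i _ BiG].
  have near_B : \forall k \near U, B k G.
    by apply: ooU; exists i => // j ij; exact: B_mono BiG.
  have near_la : \forall k \near U, lim (la k G @[k --> U]) - d < la k G.
    by apply: cvgr_gt (la_cvg UU) _ _; rewrite ltrBlDr ltrDl.
  by apply: filterS (filterI near_B near_la) => k [BkG /ltW].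
have [i iP] := filter_ex near_Gs; exists i => G GGs j jw.
have [BiG laG] := iP G GGs.
have BGE : B i.+1 (G `&` E i j).
  by have [_ BI _] := Balg i.+1; apply: BI; [exact: B_step|exact: EB].
split; first by exists i.+1.
rewrite (muE _ _ BGE); apply: le_trans (mu_E jw BiG).
by rewrite ler_pM2r// invr_gt0 ltr0n.
Qed.

Theorem limit_consistent_paths (N : nat) : consistent_paths E w N.
Proof.
have [U [UU ooU]] := ultraFilterLemma eventually_filter.
have la1 i : la i setT <= 1 by case/andP: (la_bounds i).
apply: (large_rows_consistent_paths N w_gt0 eps_gt0 _ _ _ _
  (limit_large_rows UU ooU)).
- exact: algebra_of_sets_bigcup.
- exact: fa_probability_lim.
- exact: fa_measure_lim la1.
apply/andP; split.
  apply: limr_ge; first exact: la_cvg.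
  by apply: nearW => i; case/andP: (la_bounds i).
by apply: limr_le; [exact: la_cvg|exact: nearW].
Qed.

End ArrayLimit.

(** * Formulas and definable sets *)

Section Formulas.
Variable L : language.

Fixpoint trename V W (f : V -> W) (t : term L V) : term L W :=
  match t with
  | tvar x => tvar (f x)
  | tapp g ts => tapp g (fun i => trename f (ts i))
  end.

Fixpoint frename V W (f : V -> W) (phi : formula L V) : formula L W :=
  match phi with
  | fbot => fbot
  | feq s t => feq (trename f s) (trename f t)
  | fatom r ts => fatom r (fun i => trename f (ts i))
  | fimp p q => fimp (frename f p) (frename f q)
  | fall p => fall (frename (omap f) p)
  end.

Definition ftrue V : formula L V := fimp fbot fbot.
Definition fand V (p q : formula L V) : formula L V := fnot (fimp p (fnot q)).
Definition fconj V (s : seq (formula L V)) : formula L V :=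
  foldr (@fand V) (ftrue V) s.
Definition fex V (p : formula L (option V)) : formula L V :=
  fnot (fall (fnot p)).

Definition shift_var n W (x : 'I_n.+1 + W) : option ('I_n + W) :=
  match x with
  | inl i => omap inl (unlift ord0 i)
  | inr y => Some (inr y)
  end.

Definition of_I0 T (i : 'I_0) : T := False_rect T (notF (ltn_ord i)).

Definition drop_var W (x : 'I_0 + W) : W :=
  match x with inl i => of_I0 W i | inr y => y end.

Fixpoint fexs n W : formula L ('I_n + W) -> formula L W :=
  match n with
  | 0 => fun phi => frename (@drop_var W) phi
  | n'.+1 => fun phi => fexs (fex (frename (@shift_var n' W) phi))
  end.

Definition in_params n m W (y : 'I_m -> W) (z : 'I_n + 'I_m) : 'I_n + W :=
  match z with inl i => inl i | inr j => inr (y j) end.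

(* "exists x, phi(x, y_i) for all i in s", the y_i being tuples of variables. *)
Definition fjoint n m W (I : Type) (phi : formula L ('I_n + 'I_m))
    (y : I -> 'I_m -> W) (s : seq I) : formula L W :=
  fexs (fconj [seq frename (in_params (y i)) phi | i <- s]).

Section Sat.
Variable C : structure L.

Definition joinval n W (a : 'I_n -> C) (v : W -> C) (x : 'I_n + W) : C :=
  match x with inl i => a i | inr y => v y end.

Lemma eval_trename V W (f : V -> W) (v : W -> C) t :
  eval v (trename f t) = eval (v \o f) t.
Proof. by elim: t => //= g ts IH; congr (fint C g _); exact/funext. Qed.

Lemma sat_frename V W (f : V -> W) (v : W -> C) phi :
  sat v (frename f phi) <-> sat (v \o f) phi.
Proof.
elim: phi W f v => {V}[V|V s t|V r ts|V p IHp q IHq|V p IH] W f v //=.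
- by rewrite !eval_trename.
- by under eq_fun do rewrite eval_trename.
- by split=> pq /IHp /pq /IHq.
- have oappE c : oapp v c \o omap f = oapp (v \o f) c by apply/funext => -[].
  by split=> satp c; [rewrite -oappE|]; apply/IH; rewrite ?oappE.
Qed.

Lemma sat_fand V (v : V -> C) p q : sat v (fand p q) <-> sat v p /\ sat v q.
Proof.
split=> /= [npq|[satp satq]]; last by apply.
by split; apply: contrapT => nsat; apply: npq => // satp satq; exact: nsat.
Qed.

Lemma sat_fconj V (v : V -> C) (I : eqType) (F : I -> formula L V) (s : seq I) :
  sat v (fconj [seq F i | i <- s]) <-> {in s, forall i, sat v (F i)}.
Proof.
elim: s => [|i s IH]; first by split=> // _ [].
rewrite (_ : fconj _ = fand (F i) (fconj [seq F i | i <- s]))//.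
rewrite sat_fand IH; split=> [[sati sats] j|satis].
  by rewrite inE => /predU1P[->|/sats].
by split=> [|j js]; apply: satis; rewrite inE ?eqxx ?js ?orbT.
Qed.

Lemma sat_fex V (v : V -> C) p : sat v (fex p) <-> exists c, sat (oapp v c) p.
Proof.
by split=> /= [/existsNP[c /contrapT satc]|[c satc] /(_ c)]; [exists c|exact].
Qed.

Lemma sat_fexs n W (v : W -> C) (phi : formula L ('I_n + W)) :
  sat v (fexs phi) <-> exists a, sat (joinval a v) phi.
Proof.
elim: n phi => [|n IH] phi /=.
  have dropE a : v \o @drop_var W = joinval a v by apply/funext => -[[]|].
  rewrite sat_frename; split=> [|[a]]; last by rewrite (dropE a).
  by rewrite (dropE (of_I0 C)) => satphi; exists (of_I0 C).
rewrite IH; split=> [[a /sat_fex[c /sat_frename satphi]]|[a satphi]].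
  exists (fun i => oapp a c (unlift ord0 i)); move: satphi; congr sat.
  by apply/funext => -[i|y] //=; case: (unlift ord0 i).
exists (fun i => a (lift ord0 i)); apply/sat_fex; exists (a ord0).
apply/sat_frename; move: satphi; congr sat; apply/funext => -[i|y] //=.
by case: unliftP => [j ->|->].
Qed.

Lemma sat_fjoint n m W (I : eqType) (phi : formula L ('I_n + 'I_m))
    (y : I -> 'I_m -> W) (s : seq I) (v : W -> C) :
  sat v (fjoint phi y s) <->
  exists a, {in s, forall i, defset phi (v \o y i) a}.
Proof.
have joinE a i : joinval a v \o in_params (y i) = valpair a (v \o y i).
  by apply/funext => -[].
rewrite sat_fexs; split=> -[a aP]; exists a.
  by move=> i si; have /sat_fconj/(_ i si)/sat_frename := aP; rewrite joinE.
by apply/sat_fconj => i si; apply/sat_frename; rewrite joinE; exact: aP.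
Qed.

Lemma eval_automorphism (s : C -> C) V (v : V -> C) (t : term L V) :
  automorphism s -> eval (s \o v) t = s (eval v t).
Proof.
move=> [_ sf _]; elim: t => //= f ts IH; rewrite sf; congr (fint C f _).
exact/funext.
Qed.

Lemma sat_automorphism (s : C -> C) V (v : V -> C) (phi : formula L V) :
  automorphism s -> sat (s \o v) phi <-> sat v phi.
Proof.
move=> s_auto; elim: phi v => {V}[V|V t u|V r ts|V p IHp q IHq|V p IH] v //=.
- rewrite !eval_automorphism//; split=> [|->//].
  by case: s_auto => /bij_inj s_inj _ _ /s_inj.
- under eq_fun do rewrite eval_automorphism//.
  by case: s_auto => _ _ /(_ r) <-.
- by rewrite IHp IHq.
- have [[t st ts] _ _] := s_auto.
  have oappE c : oapp (s \o v) (s c) = s \o oapp v c by apply/funext => -[].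
  split=> satp c; first by apply/IH; rewrite -oappE.
  by rewrite -(ts c) oappE; apply/IH.
Qed.

End Sat.
End Formulas.

Section DefinableSets.
Variables (L : language) (C : structure L) (n : nat).
Implicit Types (A : set C) (D E : set ('I_n -> C)).

Lemma definable_mono A A' D : A `<=` A' -> definable A D -> definable A' D.
Proof.
by move=> AA' [m [phi [b [bA ->]]]]; exists m, phi, b; split=> // j; exact: AA'.
Qed.

Lemma definable_defset A m (phi : formula L ('I_n + 'I_m)) b :
  (forall j, A (b j)) -> definable A (defset phi b).
Proof. by move=> bA; exists m, phi, b. Qed.

Lemma definableT A : definable A [set: 'I_n -> C].
Proof.
exists 0%N, (ftrue L _), (of_I0 C).
split=> [[]//|]; apply/seteqP; split=> // a _; exact: id.
Qed.

Lemma definableC A D : definable A D -> definable A (~` D).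
Proof. by move=> [m [phi [b [bA ->]]]]; exists m, (fnot phi), b. Qed.

Lemma definableI A D E :
  definable A D -> definable A E -> definable A (D `&` E).
Proof.
move=> [m [phi [b [bA ->]]]] [m' [phi' [b' [bA' ->]]]].
exists (m + m')%N, (fand (frename (in_params (@lshift m m')) phi)
                         (frename (in_params (@rshift m m')) phi')).
pose bb' (j : 'I_(m + m')) :=
  match fintype.split j with inl i => b i | inr i => b' i end.
exists bb'; split=> [j|]; first by rewrite /bb'; case: fintype.split.
have bbl a : valpair a bb' \o in_params (@lshift m m') = valpair a b.
  by apply/funext => -[i|i] //=; rewrite /bb' (unsplitK (inl i)).
have bbr a : valpair a bb' \o in_params (@rshift m m') = valpair a b'.
  by apply/funext => -[i|i] //=; rewrite /bb' (unsplitK (inr i)).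
apply/funext => a; apply/propext; apply: iff_trans (iff_sym (sat_fand _ _ _)).
by rewrite !sat_frename bbl bbr.
Qed.

Lemma definable_algebra A : algebra_of_sets (@definable L C n A).
Proof. by split; [exact: definableT|exact: definableI|exact: definableC]. Qed.

End DefinableSets.

Lemma consistent_rangeP L (C : structure L) n (I : eqType)
    (D : I -> set ('I_n -> C)) :
  consistent (range D) <-> forall s : seq I, exists a, {in s, forall i, D i a}.
Proof.
split=> [Dcons s|Dfin _ /finite_seqP[l ->] lD].
  have [||a aP] := Dcons [set D i | i in [set` s]].
  - exact/finite_image/finite_seq.
  - by move=> _ [i _ <-]; exists i.
  - by exists a => i si; apply: aP; exists i.
suff [s sP] : exists s : seq I, {in l, forall E, exists2 i, i \in s & D i = E}.
  by have [a aP] := Dfin s; exists a => E /sP[i /aP Dia <-].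
elim: l lD => [|E l IH] lD; first by exists [::].
have [F lF|s sP] := IH; first by apply: lD; rewrite /= inE lF orbT.
have [|i _ DiE] := lD E; first by rewrite /= mem_head.
exists (i :: s) => F; rewrite inE => /predU1P[->|/sP[j js <-]].
  by exists i; rewrite ?mem_head.
by exists j; rewrite // inE js orbT.
Qed.

Lemma consistent_natP L (C : structure L) n (D : nat -> set ('I_n -> C)) :
  consistent (range D) <-> forall N, exists a, forall i, (i < N)%N -> D i a.
Proof.
rewrite consistent_rangeP; split=> [Dfin N|Dinit s].
  have [a aP] := Dfin (iota 0 N).
  by exists a => i iN; apply: aP; rewrite mem_iota.
have [a aP] := Dinit (\max_(i <- s) i).+1; exists a => i si; apply: aP.
by rewrite ltnS; exact: leq_bigmax_seq.
Qed.

(** * Compactness for countably many variables *)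

Section FiniteSupport.
Variables (L : language) (C : structure L).

Lemma eval_finite_support V (t : term L V) : exists A : set V,
  finite_set A /\ forall v v' : V -> C, (forall x, A x -> v x = v' x) ->
    eval v t = eval v' t.
Proof.
elim: t => [x|f ts /choice[A AP]].
  by exists [set x]; split=> // v v'; exact.
exists (\bigcup_i A i); split=> [|v v' vv'] /=.
  by apply: bigcup_finite => [|i _]; [exact: finite_finset|case: (AP i)].
congr (fint C f _); apply/funext => i; apply: (AP i).2 => x Aix.
by apply: vv'; exists i.
Qed.

Lemma sat_finite_support V (phi : formula L V) : exists A : set V,
  finite_set A /\ forall v v' : V -> C, (forall x, A x -> v x = v' x) ->
    sat v phi <-> sat v' phi.
Proof.
elim: phi => {V}[V|V s t|V r ts|V p [A [Afin AP]] q [B [Bfin BP]]|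
                 V p [A [Afin AP]]] /=.
- by exists set0; split=> //; exact: finite_set0.
- have [A [Afin AP]] := eval_finite_support s.
  have [B [Bfin BP]] := eval_finite_support t.
  exists (A `|` B); split=> [|v v' vv']; first by rewrite finite_setU.
  rewrite (AP v v') ?(BP v v')// => x.
    by move=> Bx; apply: vv'; right.
  by move=> Ax; apply: vv'; left.
- have /choice[A AP] := fun i => eval_finite_support (ts i).
  exists (\bigcup_i A i); split=> [|v v' vv'].
    by apply: bigcup_finite => [|i _]; [exact: finite_finset|case: (AP i)].
  suff -> : (fun i => eval v (ts i)) = (fun i => eval v' (ts i)) by [].
  by apply/funext => i; apply: (AP i).2 => x Aix; apply: vv'; exists i.
- exists (A `|` B); split=> [|v v' vv']; first by rewrite finite_setU.
  rewrite (AP v v') ?(BP v v')// => x.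
    by move=> Bx; apply: vv'; right.
  by move=> Ax; apply: vv'; left.
- exists (Some @^-1` A); split=> [|v v' vv'].
    by apply: finite_preimage => // x y _ _ [].
  have vv'c c : sat (oapp v c) p <-> sat (oapp v' c) p.
    by apply: AP => -[x|] //= /vv'.
  by split=> satp c; apply/vv'c.
Qed.

Lemma sat_bounded_support (phi : formula L nat) : exists B,
  forall v v' : nat -> C, (forall i, (i < B)%N -> v i = v' i) ->
    sat v phi <-> sat v' phi.
Proof.
have [_ [/finite_seqP[s ->] sP]] := sat_finite_support phi.
exists (\max_(i <- s) i).+1 => v v' vv'; apply: sP => i si; apply: vv'.
by rewrite ltnS; exact: leq_bigmax_seq.
Qed.

End FiniteSupport.

Section Compactness.
Variables (L : language) (C : structure L) (K : Type).
Hypotheses (Kinf : infinite_set [set: K]) (Csat : saturated K C).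

Lemma definable_next_value (theta : formula L nat) (t : nat) (u : nat -> C) :
  definable (u @` `I_t) [set y : 'I_1 -> C | exists v : nat -> C,
    [/\ forall i, (i < t)%N -> v i = u i, v t = y ord0 & sat v theta]].
Proof.
have [B BP] := sat_bounded_support C theta.
pose split_var i : 'I_B.+1 + ('I_1 + 'I_t) :=
  if insub i is Some j then inr (inr j)
  else if i == t then inr (inl ord0) else inl (inord i).
exists t, (fexs (frename split_var theta)), (fun j => u j).
split=> [j|]; first by exists j => //=.
pose value y (a : 'I_B.+1 -> C) i :=
  joinval a (valpair y (fun j : 'I_t => u j)) (split_var i).
have value_lt y a i : (i < t)%N -> value y a i = u i.
  by move=> it; rewrite /value /split_var insubT.
have value_eq y a : value y a t = y ord0.
  by rewrite /value /split_var insubF ?ltnn// eqxx.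
have value_gt y a i : (t < i)%N -> value y a i = a (inord i).
  by move=> ti; rewrite /value /split_var insubF ?gtn_eqF// ltnNge (ltnW ti).
apply/seteqP; split=> y; rewrite /defset [X in X -> _]/mkset.
  move=> [v [vu vt thetav]]; apply/(sat_fexs (valpair y _)).
  exists (fun i => v i).
  apply/sat_frename; apply: (iffLR (BP v _ _) thetav) => i iB.
  transitivity (value y (fun j : 'I_B.+1 => v j) i); last by [].
  have [it|ti|->] := ltngtP i t; last by rewrite value_eq.
    by rewrite value_lt// vu.
  by rewrite value_gt// inordK// ltnW.
move=> /sat_fexs[a /sat_frename thetav]; exists (value y a).
by split=> // i; exact: value_lt.
Qed.

Section Realization.
Variables (I : eqType) (Gam : I -> formula L nat).

Definition extendable (t : nat) (u : nat -> C) : Prop := forall s : seq I,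
  exists v, (forall i, (i < t)%N -> v i = u i) /\
            {in s, forall i, sat v (Gam i)}.

Lemma extendable_next t u : extendable t u ->
  exists u', extendable t.+1 u' /\ forall i, (i < t)%N -> u' i = u i.
Proof.
move=> ext; pose D (s : seq I) := [set y : 'I_1 -> C | exists v : nat -> C,
  [/\ forall i, (i < t)%N -> v i = u i, v t = y ord0 &
      sat v (fconj [seq Gam i | i <- s])]].
have Dcat s s' : D (s ++ s') `<=` D s `&` D s'.
  by move=> y [v [vu vt /sat_fconj vss']]; split; exists v; split=> //;
    apply/sat_fconj => i si; apply: vss'; rewrite mem_cat si ?orbT.
have D0 s : exists y, D s y.
  have [v [vu /sat_fconj vs]] := ext s.
  by exists (fun=> v t), v.
have u_small : small K (u @` `I_t).
  by apply: card_lt_finite => //; exact/finite_image/finite_II.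
have [||y yP] := Csat u_small (p := range D).
- by move=> _ [s _ <-]; exact: definable_next_value.
- apply/consistent_rangeP => ss.
  suff [s sD] : exists s, {in ss, forall s', D s `<=` D s'}.
    by have [y Dy] := D0 s; exists y => s' /sD; exact.
  elim: ss => [|s' ss [s sD]]; first by exists [::].
  exists (s' ++ s) => s0; rewrite inE => /predU1P[->|/sD].
    by move=> y /Dcat[].
  by apply: subset_trans => y /Dcat[].
exists (fun i => if i == t then y ord0 else u i).
split=> [s|i it]; last by rewrite ltn_eqF.
have [|v [vu vt /sat_fconj vs]] := yP (D s); first by exists s.
exists v; split=> // i; rewrite ltnS leq_eqVlt.
by case: eqP => [->//|_ /= it]; exact: vu.
Qed.

Lemma realize_nat :
  (forall s : seq I, exists v : nat -> C, {in s, forall i, sat v (Gam i)}) ->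
  exists v : nat -> C, forall i, sat v (Gam i).
Proof.
move=> fin; have [c0] := dom_inhabited C.
pose stage := {p : nat * (nat -> C) | extendable p.1 p.2}.
pose next (p q : stage) := (sval q).1 = (sval p).1.+1 /\
  forall i, (i < (sval p).1)%N -> (sval q).2 i = (sval p).2 i.
have next_total p : {q | next p q}.
  apply: cid; case: p => -[t u] ext.
  have [u' [ext' uu']] := extendable_next ext.
  by exists (exist _ (t.+1, u') ext').
have ext0 : extendable 0 (fun=> c0).
  by move=> s; have [v vs] := fin s; exists v.
have [f [f0 fnext]] :=
  dependent_choice next_total (exist _ (0%N, fun=> c0) ext0).
have stageE t : (sval (f t)).1 = t.
  by elim: t => [|t IH]; [rewrite f0|rewrite (fnext t).1 IH].
pose v i := (sval (f i.+1)).2 i.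
have fv t i : (i < t)%N -> (sval (f t)).2 i = v i.
  elim: t => // t IH; rewrite ltnS leq_eqVlt => /predU1P[->//|it].
  by rewrite (fnext t).2 ?IH// stageE.
exists v => i; have [B BP] := sat_bounded_support C (Gam i).
have [v' [v'f /(_ i (mem_head _ _)) v'i]] := svalP (f B) [:: i].
by apply: (iffLR (BP v' v _) v'i) => j jB; rewrite v'f ?stageE// fv.
Qed.

End Realization.

Theorem countable_compactness (V : countType) (I : eqType)
    (Gam : I -> formula L V) :
  (forall s : seq I, exists v : V -> C, {in s, forall i, sat v (Gam i)}) ->
  exists v : V -> C, forall i, sat v (Gam i).
Proof.
move=> fin; have [c0] := dom_inhabited C.
have [s|v vP] := realize_nat (Gam := fun i => frename pickle (Gam i)).
  have [v vs] := fin s; exists (fun k => oapp v c0 (unpickle k)) => i si.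
  apply/sat_frename; have := vs i si; congr sat.
  by apply/funext => x /=; rewrite pickleK.
by exists (v \o pickle) => i; apply/sat_frename.
Qed.

End Compactness.

(** * Dividing and arrays *)

Section Dividing.
Variables (L : language) (C : structure L).
Implicit Types A : set C.

Definition k_divides n m A (phi : formula L ('I_n + 'I_m)) (k : nat)
    (b : 'I_m -> C) : Prop :=
  exists bs : nat -> 'I_m -> C,
    [/\ indiscernible A bs, bs 0%N = b &
        k_inconsistent k (fun j => defset phi (bs j))].

Lemma indiscernible_mono m A A' (bs : nat -> 'I_m -> C) :
  A `<=` A' -> indiscernible A' bs -> indiscernible A bs.
Proof.
by move=> AA' bs_ind k p psi c i j cA; apply: bs_ind => q; exact: AA'.
Qed.

Lemma k_divides_mono n m A A' (phi : formula L ('I_n + 'I_m)) k b :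
  A `<=` A' -> k_divides A' phi k b -> k_divides A phi k b.
Proof.
move=> AA' [bs [bs_ind bs0 bs_inc]].
by exists bs; split=> //; exact: indiscernible_mono bs_ind.
Qed.

Lemma divides_k_divides n m A (phi : formula L ('I_n + 'I_m)) b :
  divides A phi b -> exists k, k_divides A phi k b.
Proof.
move=> [bs [bs_ind bs0 /consistent_natP/existsNP[k Nk]]].
exists k, bs; split=> // s s_uniq sk [a aP]; apply: Nk.
pose t := sort leq s; have tk : size t = k by rewrite size_sort.
have t_sorted : sorted ltn t.
  by rewrite ltn_sorted_uniq_leq sort_uniq s_uniq sort_sorted//;
    exact: leq_total.
pose entry (i : 'I_k) (j : 'I_m) : 'I_k * 'I_m + 'I_0 := inl (i, j).
pose psi := fjoint phi entry (enum 'I_k).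
have [|||_ psi_initial] :=
    bs_ind k 0%N psi (of_I0 C) val (fun r => nth 0%N t r) => //.
- by case.
- by move=> r r' rr'; apply: (sorted_ltn_nth ltn_trans) => //;
    rewrite inE tk ltn_ord.
have /psi_initial/sat_fjoint[x xP] :
    sat (seqval bs (fun r => nth 0%N t r) (of_I0 C)) psi.
  apply/sat_fjoint; exists a => i _; apply: aP.
  by rewrite -(mem_sort leq) mem_nth// tk.
by exists x => i ik; exact: (xP (Ordinal ik) (mem_enum _ _)).
Qed.

Definition finite_array n m (phi : formula L ('I_n + 'I_m)) (k N : nat)
    (a : nat -> nat -> 'I_m -> C) : Prop :=
  (forall i, k_inconsistent k (fun j => defset phi (a i j))) /\
  forall eta : nat -> nat, (forall i, (eta i < N)%N) ->
    exists x, forall i, (i < N)%N -> defset phi (a i (eta i)) x.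

Section ArrayTheory.
Variables (n m : nat) (phi : formula L ('I_n + 'I_m)) (k : nat).

Let entry (i j : nat) (s : 'I_m) : nat * nat * 'I_m := (i, j, s).

Definition array_constraint : Type :=
  (nat * {s : seq nat | uniq s && (size s == k)} + seq nat)%type.

(* [inl (i, s)]: the entries of row [i] with columns in [s] are inconsistent;
   [inr eta]: the initial segment [eta] of a path is consistent. *)
Definition array_theory (g : array_constraint) :
    formula L (nat * nat * 'I_m)%type :=
  match g with
  | inl (i, s) => fnot (fjoint phi (entry i) (val s))
  | inr eta => fjoint phi (fun i => entry i (nth 0%N eta i)) (iota 0 (size eta))
  end.

Definition path_bound (g : array_constraint) : nat :=
  if g is inr eta then maxn (size eta) (\max_(j <- eta) j) else 0%N.

Lemma array_theory_TP2 (v : nat * nat * 'I_m -> C) :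
  (forall g, sat v (array_theory g)) -> TP2 C phi.
Proof.
move=> vP; exists (fun i j => v \o entry i j), k.
split=> [eta|i s s_uniq sk [x xP]].
  apply/consistent_natP => N; have /sat_fjoint[x xP] := vP (inr (mkseq eta N)).
  exists x => i iN; have := xP i.
  by rewrite size_mkseq mem_iota add0n iN nth_mkseq//; exact.
have s_ok : uniq s && (size s == k) by rewrite s_uniq sk eqxx.
by apply: (vP (inl (i, exist _ s s_ok))); apply/sat_fjoint; exists x.
Qed.

Lemma finite_array_sat (N : nat) (a : nat -> nat -> 'I_m -> C) g :
  finite_array phi k N a -> (path_bound g < N)%N ->
  sat (fun x => a x.1.1 x.1.2 x.2) (array_theory g).
Proof.
move=> [a_row a_path]; case: g => [[i [s /= /andP[s_uniq /eqP sk]]] _|eta /=].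
  by move=> /sat_fjoint[x xP]; apply: (a_row i s s_uniq sk); exists x.
rewrite gtn_max => /andP[etaN eta_lt]; apply/sat_fjoint.
have [i|x xP] := a_path (nth 0%N eta).
  have [ieta|ieta] := ltnP i (size eta); last first.
    by rewrite nth_default//; exact: leq_ltn_trans etaN.
  by apply: leq_ltn_trans eta_lt; apply: leq_bigmax_seq => //; exact: mem_nth.
by exists x => i; rewrite mem_iota => ieta; apply: xP; exact: ltn_trans etaN.
Qed.

Lemma finite_arrays_TP2 (K : Type) : infinite_set [set: K] -> saturated K C ->
  (forall N, (0 < N)%N -> exists a, finite_array phi k N a) -> TP2 C phi.
Proof.
move=> Kinf Csat arrays.
have [cs|v vP] := countable_compactness Kinf Csat (Gam := array_theory);
  last exact: array_theory_TP2 vP.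
have [//|a aP] := arrays (\max_(g <- cs) path_bound g).+1.
exists (fun x => a x.1.1 x.1.2 x.2) => g cs_g; apply: (finite_array_sat aP).
by rewrite ltnS; exact: leq_bigmax_seq.
Qed.

End ArrayTheory.
End Dividing.

(** * Conjugation over a small set *)

Section Conjugation.
Variables (L : language) (C : structure L) (K : Type).
Hypotheses (Kinf : infinite_set [set: K]) (Chom : strongly_homogeneous K C).
Implicit Types A : set C.

Definition same_type m A (b b' : 'I_m -> C) : Prop :=
  forall p (phi : formula L ('I_m + 'I_p)) (c : 'I_p -> C),
    (forall q, A (c q)) -> sat (valpair b c) phi <-> sat (valpair b' c) phi.

Lemma indiscernible_same_type m A (bs : nat -> 'I_m -> C) i j :
  indiscernible A bs -> same_type A (bs i) (bs j).
Proof.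
move=> bs_ind p phi c cA.
pose z (x : 'I_m + 'I_p) : 'I_1 * 'I_m + 'I_p :=
  match x with inl s => inl (ord0, s) | inr q => inr q end.
have zE l : seqval bs (fun=> l) c \o z = valpair (bs l) c.
  by apply/funext => -[].
by rewrite -!zE -!sat_frename; apply: bs_ind => // r r'; rewrite !ord1.
Qed.

Lemma same_type_map m A (b b' : 'I_m -> C) : same_type A b b' ->
  exists h : C -> C, (forall c, A c -> h c = c) /\ h \o b = b'.
Proof.
move=> bb'; have b_eq s s' : b s = b s' -> b' s = b' s'.
  pose eq_vars : formula L ('I_m + 'I_0) := feq (tvar (inl s)) (tvar (inl s')).
  by move=> bss'; apply/(bb' _ eq_vars (of_I0 C)) => // -[].
have b_A s a : A a -> b s = a -> b' s = a.
  pose eq_param : formula L ('I_m + 'I_1) :=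
    feq (tvar (inl s)) (tvar (inr ord0)).
  by move=> Aa bsa; apply/(bb' _ eq_param (fun=> a)).
have /choice[h hP] c :
    exists d, (A c -> d = c) /\ forall s, b s = c -> d = b' s.
  have [Ac|NAc] := pselect (A c).
    by exists c; split=> // s bsc; rewrite (b_A s c).
  have [[s bsc]|Nb] := pselect (exists s, b s = c).
    by exists (b' s); split=> // s' bs'c; apply: b_eq; rewrite bsc bs'c.
  by exists c; split=> // s bsc; case: Nb; exists s.
exists h; split=> [c|]; first by case: (hP c).
by apply/funext => s; exact: (hP (b s)).2.
Qed.

Lemma same_type_elementary m A (b b' : 'I_m -> C) (h : C -> C) : A !=set0 ->
  same_type A b b' -> (forall c, A c -> h c = c) -> h \o b = b' ->
  elementary_on (A `|` range b) h.
Proof.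
move=> [a0 Aa0] bb' hA hb q phi a aAb.
pose c i := if pselect (A (a i)) then a i else a0.
have /choice[z zP] i : exists z : 'I_m + 'I_q,
    valpair b c z = a i /\ valpair b' c z = h (a i).
  have [Aai|[s _ bs]] := aAb i; last by exists (inl s); rewrite /= -hb -bs.
  by exists (inr i); rewrite /= /c hA//; case: pselect.
have aE : a = valpair b c \o z.
  by apply/funext => i; case: (zP i).
have haE : (fun i => h (a i)) = valpair b' c \o z.
  by apply/funext => i; case: (zP i).
rewrite haE aE -!sat_frename; apply: bb' => i.
by rewrite /c; case: pselect.
Qed.

Lemma same_type_conjugate m A (b b' : 'I_m -> C) : A !=set0 -> small K A ->
  same_type A b b' ->
  exists s, [/\ automorphism s, forall c, A c -> s c = c & s \o b = b'].
Proof.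
move=> A0 Asmall bb'; have [h [hA hb]] := same_type_map bb'.
have Ab_small : small K (A `|` range b).
  apply: card_lt_setU => //; apply: card_lt_finite => //.
  exact/finite_image/finite_finset.
have [s s_auto sh] := Chom Ab_small (same_type_elementary A0 bb' hA hb).
exists s; split=> [//|c Ac|].
  by rewrite sh ?hA//; apply/mem_set; left.
by rewrite -hb; apply/funext => i /=; apply: sh; apply/mem_set; right; exists i.
Qed.

Definition conjset n (s : C -> C) (D : set ('I_n -> C)) : set ('I_n -> C) :=
  (fun a : 'I_n -> C => s \o a) @^-1` D.

Lemma conjset_defset n m (s : C -> C) (phi : formula L ('I_n + 'I_m)) b :
  automorphism s -> conjset s (defset phi (s \o b)) = defset phi b.
Proof.
move=> s_auto; apply/funext => a; apply/propext.
have valE : valpair (s \o a) (s \o b) = s \o valpair a b by apply/funext => -[].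
by rewrite /conjset /defset /= valE; exact: sat_automorphism.
Qed.

Lemma conjset_definable n (s : C -> C) A (D : set ('I_n -> C)) :
  automorphism s -> (forall c, A c -> s c = c) -> definable A D ->
  conjset s D = D.
Proof.
move=> s_auto sA [m [phi [b [bA ->]]]].
rewrite -[RHS](conjset_defset phi b s_auto).
by congr (conjset s (defset phi _)); apply/funext => j /=; rewrite sA.
Qed.

Lemma average_conjugates (R : realType) n m A (phi : formula L ('I_n + 'I_m))
    (bs : nat -> 'I_m -> C) (nu : set ('I_n -> C) -> R) (w : nat) :
  A !=set0 -> small K A -> indiscernible A bs -> fa_probability nu ->
  (0 < w)%N ->
  exists mu : set ('I_n -> C) -> R, [/\ fa_probability mu, extends A nu mu &
    forall j D, (j < w)%N -> definable A D ->
      nu (D `&` defset phi (bs 0%N)) / w%:R <= mu (D `&` defset phi (bs j))].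
Proof.
move=> A0 Asmall bs_ind [num nu1] w0.
have /choice[s sP] j :=
  same_type_conjugate A0 Asmall (indiscernible_same_type 0%N j bs_ind).
pose mu D := w%:R^-1 * \sum_(j < w) nu (conjset (s j) D).
have mum : fa_measure mu.
  apply: fa_measure_scale; first by rewrite invr_ge0.
  by apply: fa_measure_sum => j; exact: fa_measure_preimage.
have mu_ext : extends A nu mu.
  move=> D dD; rewrite /mu (eq_bigr (fun=> nu D)) => [|j _]; last first.
    by have [s_auto sA _] := sP j; rewrite (conjset_definable s_auto sA dD).
  by rewrite sumr_const card_ord -[nu D *+ w]mulr_natl mulKf// pnatr_eq0 -lt0n.
exists mu; split=> // [|j D jw dD].
  by split=> //; rewrite mu_ext//; exact: definableT.
have [s_auto sA sb] := sP j.
have conjDj :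
    conjset (s j) (D `&` defset phi (bs j)) = D `&` defset phi (bs 0%N).
  rewrite -[in RHS](conjset_definable s_auto sA dD).
  by rewrite -(conjset_defset phi (bs 0%N) s_auto) sb.
rewrite mulrC ler_pM2l ?invr_gt0 ?ltr0n// (bigD1 (Ordinal jw))//= conjDj lerDl.
by apply: sumr_ge0 => i _; exact: num.1.
Qed.

End Conjugation.

(** * Bounding the measure of dividing instances of one formula *)

Section OneFormula.
Variables (L : language) (C : structure L) (K : Type) (R : realType) (n : nat).
Hypotheses (Kinf : infinite_set [set: K]) (Csat : saturated K C)
  (Chom : strongly_homogeneous K C).
Implicit Types (A : set C) (mu nu la : set ('I_n -> C) -> R) (eps : R).

Lemma extends_trans A A' mu nu la :
  A `<=` A' -> extends A mu nu -> extends A' nu la -> extends A mu la.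
Proof.
move=> AA' mu_nu nu_la D dD; rewrite nu_la ?mu_nu//.
exact: definable_mono dD.
Qed.

Section Formula.
Variables (m : nat) (phi : formula L ('I_n + 'I_m)) (k : nat).

Definition dividing_lt A mu eps : Prop :=
  forall nu b, fa_probability nu -> extends A mu nu -> k_divides A phi k b ->
    nu (defset phi b) < eps.

Lemma dividing_lt_mono A A' mu mu' eps : A `<=` A' -> extends A mu mu' ->
  dividing_lt A mu eps -> dividing_lt A' mu' eps.
Proof.
move=> AA' mu_mu' lt_eps nu b nup mu'_nu /(k_divides_mono AA').
by apply: lt_eps => //; exact: extends_trans mu'_nu.
Qed.

Record spread A mu eps (w : nat) A' mu' (bs : nat -> 'I_m -> C) la : Prop :=
  Spread {
  spread_params : A `<=` A';
  spread_row : forall j, (j < w)%N -> definable A' (defset phi (bs j));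
  spread_extends : extends A mu mu';
  spread_inconsistent : k_inconsistent k (fun j => defset phi (bs j));
  spread_measure : fa_measure la;
  spread_bounds : eps <= la setT <= 1;
  spread_le : forall j D, (j < w)%N -> definable A D ->
    la D / w%:R <= mu' (D `&` defset phi (bs j)) }.

Lemma ex_spread A mu eps (w : nat) : A !=set0 -> small K A -> (0 < w)%N ->
  ~ dividing_lt A mu eps ->
  exists F mu' bs la, [/\ finite_set F, fa_probability mu' &
    spread A mu eps w (A `|` F) mu' bs la].
Proof.
move=> A0 Asmall w0 Nlt.
have [nu [b [nup mu_nu [bs [bs_ind bs0 bs_inc]] eps_le]]] : exists nu b,
    [/\ fa_probability nu, extends A mu nu, k_divides A phi k b &
        eps <= nu (defset phi b)].
  apply: contrapT => Nge; apply: Nlt => nu b nup mu_nu b_div.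
  by rewrite ltNge; apply/negP => eps_le; apply: Nge; exists nu, b.
have [mu' [mu'p nu_mu' mu'_ge]] :=
  average_conjugates Kinf Chom phi A0 Asmall bs_ind nup w0.
exists [set bs j i | j in `I_w & i in setT], mu', bs,
  (fun D => nu (D `&` defset phi b)).
split=> //.
  by apply: finite_image2; [exact: finite_II|exact: finite_finset].
split.
- exact: subsetUl.
- by move=> j jw; apply: definable_defset => i; right; exists j => //; exists i.
- by move=> D dD; rewrite nu_mu'// mu_nu.
- exact: bs_inc.
- by apply: fa_measure_restrict; case: nup.
- by rewrite setTI eps_le; have /andP[] := fa_probability01 (defset phi b) nup.
- by rewrite -bs0; exact: mu'_ge.
Qed.

Lemma spreads_finite_array eps w (A : nat -> set C)
    (mu la : nat -> set ('I_n -> C) -> R) (bs : nat -> nat -> 'I_m -> C) :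
  (0 < w)%N -> 0 < eps -> (forall i, fa_probability (mu i)) ->
  (forall i, spread (A i) (mu i) eps w (A i.+1) (mu i.+1) (bs i) (la i)) ->
  exists a : nat -> nat -> 'I_m -> C, finite_array phi k w a.
Proof.
move=> w0 eps0 mup A_spread.
have [h hP] : consistent_paths (fun i j => defset phi (bs i j)) w w.
  apply: (limit_consistent_paths (B := fun i => definable (A i)) (mu := mu)
    (la := la) (eps := eps)) => //.
  - by move=> i; exact: definable_algebra.
  - by move=> i D; exact: definable_mono (spread_params (A_spread i)).
  - by move=> i D; exact: (spread_extends (A_spread i)).
  - by move=> i; exact: spread_measure (A_spread i).
  - by move=> i; exact: spread_bounds (A_spread i).
  - by move=> i j; exact: (spread_row (A_spread i)).
  - by move=> i j D; exact: (spread_le (A_spread i)).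
exists (fun i => bs (h i)); split=> [i|//].
exact: spread_inconsistent (A_spread (h i)).
Qed.

Lemma ex_dividing_lt A mu eps : ~ TP2 C phi ->
  A !=set0 -> small K A -> fa_probability mu -> 0 < eps ->
  exists F mu', [/\ finite_set F, fa_probability mu', extends A mu mu' &
                    dividing_lt (A `|` F) mu' eps].
Proof.
move=> phi_NTP2 [a0 Aa0] Asmall mup eps0; apply: contrapT => none.
apply: phi_NTP2; apply: (finite_arrays_TP2 (k := k) Kinf Csat) => w w0.
pose stage := {p : set C * (set ('I_n -> C) -> R) |
  [/\ finite_set p.1, fa_probability p.2 & extends A mu p.2]}.
pose next (p q : stage) := exists bs la,
  spread (A `|` (sval p).1) (sval p).2 eps w
         (A `|` (sval q).1) (sval q).2 bs la.
have next_total p : {q | next p q}.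
  apply: cid; case: p => -[F nu] [/= Ffin nup mu_nu].
  have [||//||F' [nu' [bs [la [F'fin nu'p nu_spread]]]]] :=
    @ex_spread (A `|` F) nu eps w.
  - by exists a0; left.
  - by apply: card_lt_setU => //; exact: card_lt_finite.
  - by move=> lt_eps; apply: none; exists F, nu.
  have good : [/\ finite_set (F `|` F'), fa_probability nu' & extends A mu nu'].
    split=> //; first by rewrite finite_setU.
    exact: extends_trans mu_nu (spread_extends nu_spread).
  by exists (exist _ (F `|` F', nu') good), bs, la; rewrite /= setUA.
have good0 : [/\ finite_set (@set0 C), fa_probability mu & extends A mu mu].
  by split.
have [st [_ stP]] := dependent_choice next_total (exist _ (set0, mu) good0).
have [bs /choice[la nu_spread]] := choice stP.
by apply: spreads_finite_array w0 eps0 _ nu_spread => i; case: (svalP (st i)).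
Qed.

End Formula.
End OneFormula.

(** * The downward Lowenheim-Skolem theorem *)

Section FormulaCodes.
Local Open Scope card_scope.
Variable L : language.

Fixpoint term_code V Z (e : V -> Z) (t : term L V) :
    GenTree.tree (fsym L + Z) :=
  match t with
  | tvar x => GenTree.Leaf (inr (e x))
  | tapp f ts => GenTree.Node 0 (GenTree.Leaf (inl f) ::
                   [seq term_code e (ts i) | i <- enum 'I_(farity f)])
  end.

Lemma term_code_inj V Z (e : V -> Z) : injective e -> injective (term_code e).
Proof.
move=> e_inj; elim=> [x|f ts IH] [y|g us] //=; first by move=> [/e_inj ->].
case=> fg; case: _ / fg us => us /eq_in_map ts_us.
by congr tapp; apply/funext => i; apply/IH/ts_us; rewrite mem_enum.
Qed.

Fixpoint formula_code V (e : V -> nat) (phi : formula L V) :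
    GenTree.tree (GenTree.tree (fsym L + nat) + rsym L) :=
  match phi with
  | fbot => GenTree.Node 0 [::]
  | feq s t => GenTree.Node 1
      [:: GenTree.Leaf (inl (term_code e s));
          GenTree.Leaf (inl (term_code e t))]
  | fatom r ts => GenTree.Node 2 (GenTree.Leaf (inr r) ::
      [seq GenTree.Leaf (inl (term_code e (ts i))) | i <- enum 'I_(rarity r)])
  | fimp p q => GenTree.Node 3 [:: formula_code e p; formula_code e q]
  | fall p => GenTree.Node 4 [:: formula_code (oapp (succn \o e) 0%N) p]
  end.

Lemma formula_code_inj V (e : V -> nat) :
  injective e -> injective (formula_code e).
Proof.
move=> + phi; elim: phi e => {V}[V|V s t|V r ts|V p IHp q IHq|V p IH] e e_inj.
- by case.
- by case=> //= s' t' [/(term_code_inj e_inj) -> /(term_code_inj e_inj) ->].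
- case=> //= r' ts' [rr']; case: _ / rr' ts' => ts' /eq_in_map ts_ts'.
  congr fatom; apply/funext => i.
  have i_enum : i \in enum 'I_(rarity r) by rewrite mem_enum.
  by have [/(term_code_inj e_inj)] := ts_ts' i i_enum.
- by case=> //= p' q' [/(IHp _ e_inj) -> /(IHq _ e_inj) ->].
- by case=> //= p' [/IH -> //] [x|] [y|] //= [/e_inj ->].
Qed.

Variables (U : Type) (D : set U).
Hypotheses (Dinf : infinite_set D) (fsymD : [set: fsym L] #<= D).

Lemma card_le_term V : [set: V] #<= D -> [set: term L V] #<= D.
Proof.
move=> VD; apply: card_le_trans (card_le_inj (term_code_inj (@inj_id V))) _.
by apply/card_le_tree/card_le_sum.
Qed.

Lemma card_le_formula (V : countType) :
  [set: rsym L] #<= D -> [set: formula L V] #<= D.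
Proof.
move=> rsymD; have pickle_inj : injective (@pickle V) := pcan_inj pickleK.
apply: card_le_trans (card_le_inj (formula_code_inj pickle_inj)) _.
apply/card_le_tree/card_le_sum => //; apply/card_le_tree/card_le_sum => //.
exact/infiniteP.
Qed.

End FormulaCodes.

Section TarskiVaught.
Variables (L : language) (C : structure L) (N : set C).
Hypothesis witnesses : forall m (phi : formula L (option 'I_m)) (a : 'I_m -> C),
  (forall i, N (a i)) -> (exists c, sat (oapp a c) phi) ->
  exists2 c, N c & sat (oapp a c) phi.

Section Substructure.
Variables (N0 : N !=set0) (Nf : fclosed N).
Let S := substructure N0 Nf.

Lemma eval_substructure V (a : V -> S) (t : term L V) :
  sval (eval a t) = eval (fun x => sval (a x) : C) t.
Proof. by elim: t => //= f ts IH; congr (fint C f _); exact/funext. Qed.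

(* [e] and [g] witness that [V] is finite: [witnesses] only covers formulas with
   free variables in some ['I_m]. *)
Lemma sat_substructure V (phi : formula L V) m (e : V -> 'I_m) (g : 'I_m -> V) :
  cancel e g ->
  forall a : V -> S, sat a phi <-> sat (fun x => sval (a x) : C) phi.
Proof.
elim: phi m e g => {V}[V|V s t|V r ts|V p IHp q IHq|V p IH] m e g eg a //=.
- rewrite -!eval_substructure; split=> [->//|].
  by case: (eval a s) (eval a t) => c Nc [d Nd] /= cd; exact: eq_exist.
- by under [in X in _ <-> X]eq_fun do rewrite -eval_substructure.
- by rewrite (IHp _ _ _ eg) (IHq _ _ _ eg).
have {}IH (b : option V -> S) : sat b p <-> sat (fun x => sval (b x) : C) p.
  move: b; apply: (IH m.+1 (oapp (lift ord0 \o e) ord0)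
                         (fun i => omap g (unlift ord0 i))).
  by move=> [x|] /=; rewrite ?liftK ?unlift_none//= eg.
have oappE (c : S) :
    (fun x => sval (oapp a c x)) = oapp (fun x => sval (a x)) (sval c).
  by apply/funext => -[].
have omapE c : oapp (fun i => sval (a (g i)) : C) c \o omap e =
    oapp (fun x => sval (a x)) c.
  by apply/funext => -[x|] //=; rewrite eg.
split=> [satS c|satC c]; last by apply/IH; rewrite oappE.
apply: contrapT => Nc.
have [i||d Nd] := witnesses (phi := frename (omap e) (fnot p))
    (a := fun i => sval (a (g i))).
- exact: svalP.
- by exists c; apply/sat_frename; rewrite omapE.
move=> /sat_frename; rewrite omapE; apply.
by have /IH := satS (exist _ d Nd); rewrite oappE.
Qed.

End Substructure.

Lemma tarski_vaught : elementary_substructure N.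
Proof.
have [c0] := dom_inhabited C.
have N0 : N !=set0.
  have [[]//||c Nc _] := witnesses (phi := ftrue L (option 'I_0))
      (a := fun=> c0).
    by exists c0 => /=.
  by exists c.
have Nf : fclosed N.
  move=> f a aN.
  have [//||c Nc /= <-//] := witnesses
    (phi := feq (tvar None) (tapp f (fun i => tvar (Some i)))) (a := a).
  by exists (fint C f a).
by exists N0, Nf => m phi a; exact: (sat_substructure phi (e := id) (g := id)).
Qed.

End TarskiVaught.

Section SkolemHull.
Variables (L : language) (C : structure L).

(* The Skolem hull of a set is the set of values of the terms of this language
   over it, so that counting terms bounds its cardinal. *)
Definition skolem_language : language :=
  {| fsym := {m & formula L (option 'I_m)}; farity := @tag _ _;
     rsym := void; rarity := fun=> 0%N |}.

Lemma ex_skolem_function :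
  exists sk : forall f : fsym skolem_language, ('I_(farity f) -> C) -> C,
  forall m (phi : formula L (option 'I_m)) (a : 'I_m -> C),
    (exists c, sat (oapp a c) phi) -> sat (oapp a (sk (existT _ m phi) a)) phi.
Proof.
have [c0] := dom_inhabited C.
have /choice[sk skP] (u : {f : fsym skolem_language & 'I_(farity f) -> C}) :
    exists d : C, (exists c, sat (oapp (tagged u) c) (tagged (tag u))) ->
      sat (oapp (tagged u) d) (tagged (tag u)).
  have [[c cP]|N] :=
      pselect (exists c, sat (oapp (tagged u) c) (tagged (tag u))).
    by exists c.
  by exists c0.
exists (fun f a => sk (existT _ f a)) => m phi a.
exact: (skP (existT _ (existT _ m phi) a)).
Qed.

Theorem lowenheim_skolem (A : set C) U (D : set U) : infinite_set D ->
  ([set: fsym L] #<= D)%card -> ([set: rsym L] #<= D)%card -> (A #<= D)%card ->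
  exists N, [/\ A `<=` N, elementary_substructure N & (N #<= D)%card].
Proof.
move=> Dinf fsymD rsymD AD; have [sk skP] := ex_skolem_function.
pose S : structure skolem_language :=
  @Structure skolem_language C (dom_inhabited C) sk
    (fun r => match r with end).
pose hull_term (t : term skolem_language A) : C := eval (C := S) val t.
exists (range hull_term); split.
- by move=> x Ax; exists (tvar (SigSub (mem_set Ax))).
- apply: tarski_vaught => m phi a aN /skP sat_sk.
  have /choice[ts tsE] i : exists t, hull_term t = a i.
    by have [t _ ta] := aN i; exists t.
  exists (sk (existT _ m phi) a) => //.
  exists (tapp (L := skolem_language) (existT _ m phi) ts) => //=.
  by rewrite /hull_term /=; congr (sk _ _); exact/funext.
- apply: card_le_trans (card_image_le _ _) _; apply: card_le_term => //.
    by apply: card_le_sigT => // [|m]; [exact/infiniteP|exact: card_le_formula].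
  by rewrite (card_le_eql (card_setT A)).
Qed.

End SkolemHull.

(** * Solving all tasks by Zorn's lemma *)

Section Exhaustion.
Local Open Scope card_scope.
Variables (L : language) (C : structure L) (R : realType) (n : nat).
Implicit Types (A : set C) (mu : set ('I_n -> C) -> R).

Definition extends_le (p q : set C * (set ('I_n -> C) -> R)) : Prop :=
  p.1 `<=` q.1 /\ extends p.1 p.2 q.2.

Lemma extends_le_chain (F : set (set C * (set ('I_n -> C) -> R))) :
  F !=set0 -> (forall p, F p -> fa_probability p.2) -> total_on F extends_le ->
  exists2 nu, fa_probability nu & forall p, F p -> extends p.1 p.2 nu.
Proof.
move=> [p0 Fp0] Fprob tF.
pose value (p : set C * (set ('I_n -> C) -> R)) z :=
  definable p.1 z.1 /\ p.2 z.1 = z.2.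
have value_le p q z : extends_le p q -> value p z -> value q z.
  move=> [pq p_q] [dpz pz]; split; first exact: definable_mono dpz.
  by rewrite -pz; exact: p_q.
pose values := [set z | exists2 p, F p & value p z].
have [s sF|nu nup nuP] := fa_probability_compact (P := values); last first.
  by exists nu => // p Fp D dD; apply: (nuP (D, p.2 D)); exists p.
suff [p Fp ps] : exists2 p, F p & {in s, forall z, value p z}.
  by exists p.2 => [|z /ps[]//]; exact: Fprob.
elim: s sF => [|z s IH] sF; first by exists p0.
have [y ys|p Fp ps] := IH; first by apply: sF; rewrite /= inE ys orbT.
have [|q Fq qz] := sF z; first by rewrite /= mem_head.
have [pq|qp] := tF _ _ Fp Fq.
  by exists q => // y; rewrite inE => /predU1P[->//|/ps]; exact: value_le.
by exists p => // y; rewrite inE => /predU1P[->|/ps//]; exact: value_le qz.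
Qed.

Variables (T U : Type) (D : set U) (M : set C) (mu0 : set ('I_n -> C) -> R).
Variable task : T -> set C -> (set ('I_n -> C) -> R) -> Prop.
Hypotheses (Dinf : infinite_set D) (TD : [set: T] #<= D) (MD : M #<= D)
  (mu0p : fa_probability mu0).
Hypothesis task_mono : forall t A A' mu mu', A `<=` A' -> extends A mu mu' ->
  task t A mu -> task t A' mu'.
Hypothesis task_solvable : forall t A mu,
  M `<=` A -> A #<= D -> fa_probability mu ->
  exists F mu', [/\ F #<= D, fa_probability mu', extends A mu mu' &
                    task t (A `|` F) mu'].

(* A stage remembers which parameters were added to solve each task, so that
   along a chain every task keeps contributing the same parameters. *)
Record stage : Type := Stage {
  solved : set T;
  new_params : T -> set C;
  stage_measure : set ('I_n -> C) -> R }.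

Definition stage_params (s : stage) : set C :=
  M `|` \bigcup_(t in solved s) new_params s t.

Definition stage_ok (s : stage) : Prop :=
  [/\ forall t, new_params s t #<= D, fa_probability (stage_measure s),
      extends M mu0 (stage_measure s) &
      forall t, solved s t -> task t (stage_params s) (stage_measure s)].

Definition stage_le (s s' : stage) : Prop :=
  [/\ solved s `<=` solved s',
      forall t, solved s t -> new_params s' t = new_params s t &
      extends (stage_params s) (stage_measure s) (stage_measure s')].

Lemma stage_params_sub s (S : set T) (g : T -> set C) : solved s `<=` S ->
  (forall t, solved s t -> g t = new_params s t) ->
  stage_params s `<=` M `|` \bigcup_(t in S) g t.
Proof.
move=> sS gs c [Mc|[t st gc]]; first by left.
by right; exists t; [exact: sS|rewrite gs].
Qed.

Lemma stage_le_params s s' :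
  stage_le s s' -> stage_params s `<=` stage_params s'.
Proof. by move=> [? ? _]; exact: stage_params_sub. Qed.

Lemma stage_le_trans s s' s'' :
  stage_le s s' -> stage_le s' s'' -> stage_le s s''.
Proof.
move=> /[dup] /stage_le_params ss' [s_s' new_s' ext_s']
  [s'_s'' new_s'' ext_s''].
split=> [|t st|]; first exact: subset_trans s'_s''.
  by rewrite new_s'' ?new_s'//; exact: s_s'.
exact: extends_trans ext_s''.
Qed.

Lemma stage_params_card s : stage_ok s -> stage_params s #<= D.
Proof.
move=> [newD _ _ _]; apply: card_le_setU => //; apply: card_le_bigcup => //.
exact: card_le_trans (card_leT _) TD.
Qed.

Lemma stage_chain (F : set stage) :
  F !=set0 -> F `<=` stage_ok -> total_on F stage_le ->
  exists2 s, stage_ok s & forall s', F s' -> stage_le s' s.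
Proof.
move=> [s0 Fs0] Fok tF.
have [|||nu nup nu_ext] := @extends_le_chain
    [set (stage_params s, stage_measure s) | s in F].
- by exists (stage_params s0, stage_measure s0), s0.
- by move=> _ [s /Fok[_ ? _ _] <-].
- move=> _ _ [s Fs <-] [s' Fs' <-].
  have [ss'|s's] := tF _ _ Fs Fs'; [left|right].
    by split; [exact: stage_le_params|case: ss'].
  by split; [exact: stage_le_params|case: s's].
have {}nu_ext s : F s -> extends (stage_params s) (stage_measure s) nu.
  by move=> Fs; apply: (nu_ext (_, _)); exists s.
have /choice[added addedP] t :
    exists G, G #<= D /\ forall s, F s -> solved s t -> G = new_params s t.
  have [[s Fs st]|Nt] := pselect (exists2 s, F s & solved s t); last first.
    by exists set0; split=> [|s Fs st]; [exact: card_ge0|case: Nt; exists s].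
  exists (new_params s t); split=> [|s' Fs' s't]; first by case: (Fok _ Fs).
  by have [[_ new_s _]|[_ new_s _]] := tF _ _ Fs Fs'; rewrite new_s.
pose s := Stage (\bigcup_(s in F) solved s) added nu.
have le_s s' : F s' -> stage_le s' s.
  move=> Fs'; split=> [t s't|t|]; first by exists s'.
    exact: (addedP t).2.
  exact: nu_ext.
exists s => //; split=> //= [t||t [s' Fs' s't]]; first by case: (addedP t).
  have [_ _ s0_ext _] := Fok _ Fs0; apply: extends_trans s0_ext (nu_ext _ Fs0).
  exact: subsetUl.
have [_ _ _ s'_task] := Fok _ Fs'.
exact: task_mono (stage_le_params (le_s _ Fs')) (nu_ext _ Fs') (s'_task _ s't).
Qed.

Lemma stage_solve s t : stage_ok s -> ~ solved s t ->
  exists2 s', stage_ok s' & stage_le s s' /\ solved s' t.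
Proof.
move=> /[dup] s_ok [newD s_prob s_ext s_task] Nst.
have [F [mu [FD mup s_mu t_task]]] :=
  task_solvable t (@subsetUl _ _ _) (stage_params_card s_ok) s_prob.
pose added t' := if `[< t' = t >] then F else new_params s t'.
have added_s t' : solved s t' -> added t' = new_params s t'.
  by rewrite /added; case: asboolP => // t't st'; case: Nst; rewrite -t't.
have added_t : added t = F by rewrite /added; case: asboolP.
pose s' := Stage (solved s `|` [set t]) added mu.
have params_s' : stage_params s `<=` stage_params s'.
  by apply: stage_params_sub => //; exact: subsetUl.
exists s'; last by split; [split=> //; exact: subsetUl|right].
split=> //= [t'||t' [st'|->]].
- by rewrite /added; case: ifP.
- by apply: extends_trans s_ext s_mu; exact: subsetUl.
- exact: task_mono params_s' s_mu (s_task _ st').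
- apply: task_mono t_task => // c [/params_s'//|Fc].
  by right; exists t; [right|rewrite /= added_t].
Qed.

Theorem exhaust_tasks : exists A mu, [/\ M `<=` A, A #<= D, fa_probability mu,
  extends M mu0 mu & forall t, task t A mu].
Proof.
have [||||s s_ok s_max] := @Zorn_preorder_on _ stage_ok stage_le.
- by exists (Stage set0 (fun=> set0) mu0); split=> // t; exact: card_ge0.
- by move=> s; split.
- exact: stage_le_trans.
- exact: stage_chain.
have s_all t : solved s t.
  apply: contrapT => Nst; have [s' s'_ok [ss' s't]] := stage_solve s_ok Nst.
  by have [s's _ _] := s_max s' s'_ok ss'; apply: Nst; exact: s's.
have [_ s_prob s_ext s_task] := s_ok.
exists (stage_params s), (stage_measure s); split=> // [||t].
- exact: subsetUl.
- exact: stage_params_card.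
- exact/s_task/s_all.
Qed.

End Exhaustion.

(** * Smooth extensions *)

Section Smoothness.
Local Open Scope card_scope.
Variables (L : language) (C : structure L) (R : realType) (n : nat).
Implicit Types (A B : set C) (mu nu : set ('I_n -> C) -> R).

Lemma keisler_extension A mu : keisler_measure A mu ->
  exists2 nu, fa_probability nu & extends A mu nu.
Proof.
move=> [mu_ge0 mu1 muD]; apply: fa_extension => //; exact: definable_algebra.
Qed.

Lemma fa_probability_keisler A mu : fa_probability mu -> keisler_measure A mu.
Proof. by move=> [[mu_ge0 muD] mu1]; split=> // D E _ _; exact: muD. Qed.

Lemma dividing_lt_smooth A B mu : A `<=` B ->
  (forall m (phi : formula L ('I_n + 'I_m)) k q,
     dividing_lt phi k A mu q.+1%:R^-1) ->
  NTP2_smooth B mu.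
Proof.
move=> AB lt_inv B' nu BB' nu_keisler mu_nu m phi b bB' phi_div.
have [nu' nu'p nu_nu'] := keisler_extension nu_keisler.
have [k phi_kdiv] := divides_k_divides phi_div.
have mu_nu' : extends A mu nu'.
  move=> D dD; have dBD := definable_mono AB dD.
  by rewrite nu_nu' ?mu_nu//; exact: definable_mono dBD.
rewrite -nu_nu'; last exact: definable_defset.
apply/eqP; rewrite eq_le nu'p.1.1 andbT leNgt; apply/negP => /ltr_add_invr[q].
by rewrite add0r ltNge ltW//; exact: lt_inv (k_divides_mono AB phi_kdiv).
Qed.

Lemma ex_small_bound (K : Type) A : small K A -> card_lt [set: nat] [set: K] ->
  card_lt [set: fsym L] [set: K] -> card_lt [set: rsym L] [set: K] ->
  exists U (D : set U), [/\ infinite_set D, card_lt D [set: K], A #<= D,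
    [set: fsym L] #<= D & [set: rsym L] #<= D].
Proof.
move=> A_small nat_lt fsym_lt rsym_lt.
have Kinf := card_lt_nat_infinite nat_lt.
exists (A + (fsym L + (rsym L + nat)))%type, setT; split.
- by apply/infiniteP/(card_le_inj (f := inr \o (inr \o inr))) => x y [].
- have tail_lt := card_lt_sum Kinf fsym_lt (card_lt_sum Kinf rsym_lt nat_lt).
  apply: card_lt_sum => //.
  by rewrite /card_lt (card_le_eqr (card_setT A)).
- rewrite -(card_le_eql (card_setT A)).
  by apply: (card_le_inj (f := inl)) => x y [].
- by apply: (card_le_inj (f := inr \o inl)) => x y [].
- by apply: (card_le_inj (f := inr \o (inr \o inl))) => x y [].
Qed.

Section Monster.
Variable K : Type.
Hypotheses (Kinf : infinite_set [set: K]) (Csat : saturated K C)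
  (Chom : strongly_homogeneous K C) (C_NTP2 : NTP2 C).

Lemma ex_all_dividing_lt A mu U (D : set U) :
  infinite_set D -> card_lt D [set: K] ->
  [set: fsym L] #<= D -> [set: rsym L] #<= D -> A #<= D -> A !=set0 ->
  fa_probability mu ->
  exists A' mu', [/\ A `<=` A', A' #<= D, fa_probability mu', extends A mu mu' &
    forall m (phi : formula L ('I_n + 'I_m)) k q,
      dividing_lt phi k A' mu' q.+1%:R^-1].
Proof.
move=> Dinf DK fsymD rsymD AD A0 mup.
pose T := ({m & formula L ('I_n + 'I_m)} * (nat * nat))%type.
have natD : [set: nat] #<= D by exact/infiniteP.
have TD : [set: T] #<= D.
  rewrite -!setXTT; apply: card_le_setX => //; last exact: card_le_setX.
  by apply: card_le_sigT => // m; exact: card_le_formula.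
pose task (t : T) B nu : Prop :=
  dividing_lt (tagged t.1) t.2.1 B nu (t.2.2.+1%:R^-1 : R).
have [||||t B B' nu nu'|t B nu AB BD nup|A' [mu' [AA' A'D mu'p mu_mu' solved]]]
    := exhaust_tasks (D := D) (M := A) (mu0 := mu) (task := task) => //.
- exact: dividing_lt_mono.
- have [a Aa] := A0; have B0 : B !=set0 by exists a; exact: AB.
  have B_small : small K B by move=> KB; apply: DK; exact: card_le_trans BD.
  have eps0 : (0 < t.2.2.+1%:R^-1 :> R)%R by rewrite invr_gt0 ltr0n.
  have [F [nu' [Ffin nu'p nu_nu' lt_eps]]] := ex_dividing_lt Kinf Csat Chom
    t.2.1 (C_NTP2 (phi := tagged t.1)) B0 B_small nup eps0.
  exists F, nu'; split=> //.
  exact: card_le_trans (finite_set_countable Ffin) natD.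
exists A', mu'; split=> // m phi k q.
exact: (solved (existT _ m phi, (k, q))).
Qed.

End Monster.
End Smoothness.

Theorem theorem3p8 (L : language) (T : theory L) (K : Type) (C : structure L)
    (T_complete : complete_theory T) (C_monster : monster_model K T C)
    (T_NTP2 : NTP2 C)
    (M : set C) (M_elem : elementary_substructure M) (M_small : small K M)
    (R : realType) (n : nat) (mu : set ('I_n -> C) -> R)
    (mu_keisler : keisler_measure M mu) :
  exists (N : set C) (mu' : set ('I_n -> C) -> R),
    [/\ M `<=` N, elementary_substructure N & small K N] /\
    [/\ keisler_measure N mu', extends M mu mu' & NTP2_smooth N mu'].
Proof.
have [nat_lt [fsym_lt rsym_lt] _ Csat Chom] := C_monster.
have Kinf := card_lt_nat_infinite nat_lt.
have [M0 _] := M_elem.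
have [mu0 mu0p mu_mu0] := keisler_extension mu_keisler.
have [U [D [Dinf DK MD fsymD rsymD]]] :=
  ex_small_bound M_small nat_lt fsym_lt rsym_lt.
have [A [mu' [MA AD mu'p mu0_mu' all_lt]]] :=
  ex_all_dividing_lt Kinf Csat Chom T_NTP2 Dinf DK fsymD rsymD MD M0 mu0p.
have [N [AN N_elem ND]] := lowenheim_skolem Dinf fsymD rsymD AD.
exists N, mu'; split; split=> //.
- exact: subset_trans AN.
- by move=> KN; apply: DK; exact: card_le_trans ND.
- exact: fa_probability_keisler.
- exact: extends_trans mu_mu0 mu0_mu'.
- exact: dividing_lt_smooth AN all_lt.
Qed.
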